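(* Let $1\le p<\infty$ and $\mathbf{T}=\mathbf{V}P=(V_1P,\dots,V_dP)\in\mathfrak{C}_p^d(\mathcal{H})$ (canonical spherical polar decomposition). Then $\mathbf{M}_\lambda(\mathbf{T})\in\mathfrak{C}_p^d(\mathcal{H})$ for each $0\le\lambda\le1$, and $$\|\mathbf{M}_\lambda(\mathbf{T})\|_{s,p}\le\left(\lambda+(1-\lambda)\sqrt[p]{d}\right)\|\mathbf{T}\|_{s,p}.$$ In particular, $$\|\mathbf{T}^D\|_{s,p}\le\sqrt[p]{d}\,\|\mathbf{T}\|_{s,p}\quad\text{and}\quad\|\widehat{\mathbf{T}}\|_{s,p}\le\frac{1+\sqrt[p]{d}}{2}\|\mathbf{T}\|_{s,p}.$$
   Context: $\mathcal{H}$ is a separable complex Hilbert space, $\mathfrak{B}(\mathcal{H})$ the bounded linear operators on $\mathcal{H}$, and $d\in\mathbb{N}$. For $\mathbf{T}=(T_1,\dots,T_d)\in\mathfrak{B}(\mathcal{H})^d$ put $P=\sqrt{T_1^*T_1+\cdots+T_d^*T_d}$. For $1\le p<\infty$, $\mathbf{T}\in\mathfrak{C}_p^d(\mathcal{H})$ means $\mathrm{tr}(P^p)<\infty$ (equivalently, the column operator $\mathcal{H}\to\mathcal{H}^d$ with entries $T_1,\dots,T_d$ is in the Schatten $p$-class), and the spherical Schatten $p$-norm is $\|\mathbf{T}\|_{s,p}=[\mathrm{tr}(P^p)]^{1/p}$. Canonical spherical polar decomposition: $\mathbf{T}=\mathbf{V}P=(V_1P,\dots,V_dP)$, where $\mathbf{V}=(V_1,\dots,V_d)$,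 viewed as a column operator $\mathcal{H}\to\mathcal{H}^d$, is the partial isometry with initial space $\mathcal{N}(P)^\perp$; that is, $T_i=V_iP$ for all $i$ and $\sum_{i=1}^dV_i^*V_i$ is the orthogonal projection onto $\mathcal{N}(P)^\perp$. The spherical Duggal transform is $\mathbf{T}^D=(PV_1,\dots,PV_d)$; the spherical mean transform is $\widehat{\mathbf{T}}=\frac12(\mathbf{T}+\mathbf{T}^D)$; for $\lambda\in[0,1]$ the spherical $\lambda$-mean transform is $\mathbf{M}_\lambda(\mathbf{T})=\lambda\mathbf{T}+(1-\lambda)\mathbf{T}^D$ (coordinatewise operations). *)

(* Defs.v *)
From mathcomp Require Import all_boot all_order all_algebra.
From mathcomp Require Import complex.
From mathcomp Require Import all_classical all_reals all_analysis.

Set Implicit Arguments.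
Unset Strict Implicit.
Unset Printing Implicit Defensive.

Import Order.TTheory GRing.Theory Num.Theory.
Import numFieldNormedType.Exports.

Local Open Scope classical_set_scope.
Local Open Scope complex_scope.
Local Open Scope ring_scope.

(* Operators are plain functions H -> H, so that sums, scalings and
   compositions are those of the function space; membership in B(H) is the
   predicate [bounded_op].  Objects that are unique by a classical theorem
   (adjoint, positive square root, value of the functional calculus) are
   selected by [xget], with default value 0 outside their natural domain. *)

Section Operators.
Context {R : realType} {H : completeNormedModType R[i]}.
Implicit Types A B : H -> H.

Definition separable_space := exists D : set H, countable D /\ dense D.

Definition bounded_op A := linear A /\ continuous A.

Definition kernel_op A : set H := [set x | A x = 0].

Definition opnorm A : R := sup [set complex.Re `|A x| | x in [set x | `|x| <= 1]].

Definition poly_op (q : {poly R}) A : H -> H :=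
  \sum_(k < size q) (q`_k)%:C *: (fun x => iter k A x).

(* Continuous functional calculus for a positive operator A, whose spectrum
   lies in [0, ||A||]: f(A) is the operator-norm limit of q_n(A) whenever the
   real polynomials q_n converge to f uniformly on [0, ||A||]. *)
Definition is_fun_calc (f : R -> R) A B :=
  bounded_op B /\
  forall q : nat -> {poly R},
    {uniform `[0, opnorm A], (fun n t => (q n).[t]) @ \oo --> f} ->
    (fun n => opnorm (poly_op (q n) A - B)) @ \oo --> (0 : R).

Definition fun_calc (f : R -> R) A : H -> H := xget 0 (is_fun_calc f A).

Definition op_powR A (p : R) : H -> H := fun_calc (fun t => t `^ p) A.

End Operators.

Arguments separable_space {R} H.

Section Hilbert.
Context {R : realType} {H : completeNormedModType R[i]}.
Variable dot : {dot H for (@Num.conj R[i])}.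
Implicit Types A B E : H -> H.

Definition induces_norm := forall x : H, `|x| ^+ 2 = dot x x.

Definition adjoint A : H -> H :=
  xget 0 [set B | bounded_op B /\ forall x y, dot (A x) y = dot x (B y)].

Definition positive_op A := bounded_op A /\ forall x, 0 <= dot (A x) x.

Definition op_sqrt A : H -> H :=
  xget 0 [set B | positive_op B /\ B \o B = A].

Definition orth_compl (S : set H) : set H :=
  [set x | forall y, S y -> dot x y = 0].

Definition is_orth_proj E (S : set H) :=
  forall x, S (E x) /\ orth_compl S (x - E x).

Definition is_orthonormal_basis (B : set H) :=
  (forall e f, B e -> B f -> dot e f = (e == f)%:R) /\
  (forall x, (forall e, B e -> dot x e = 0) -> x = 0).

Definition orthonormal_basis : set H := xget set0 is_orthonormal_basis.

(* Only meaningful for positive A; then independent of the basis chosen. *)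
Definition trace A : \bar R :=
  \esum_(e in orthonormal_basis) (complex.Re (dot (A e) e))%:E.

Section Tuples.
Context {d : nat}.
Implicit Types T V : 'I_d -> H -> H.

Definition spherical_modulus T : H -> H :=
  op_sqrt (\sum_(i < d) (adjoint (T i) \o T i)).

Definition spherical_schatten (p : R) T :=
  (forall i, bounded_op (T i)) /\
  (trace (op_powR (spherical_modulus T) p) < +oo)%E.

Definition spherical_norm (p : R) T : \bar R :=
  (trace (op_powR (spherical_modulus T) p) `^ p^-1)%E.

Definition spherical_polar T V :=
  [/\ forall i, bounded_op (V i),
      forall i, T i = V i \o spherical_modulus T &
      is_orth_proj (\sum_(i < d) (adjoint (V i) \o V i))
                   (orth_compl (kernel_op (spherical_modulus T)))].

Definition duggal T V : 'I_d -> H -> H := fun i => spherical_modulus T \o V i.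

Definition mean_transform T V : 'I_d -> H -> H :=
  fun i => 2^-1 *: (T i + duggal T V i).

Definition lambda_mean (l : R) T V : 'I_d -> H -> H :=
  fun i => l%:C *: T i + (1 - l)%:C *: duggal T V i.

End Tuples.
End Hilbert.

(* Main.v *)
Require Import Defs.
From HB Require Import structures.
From mathcomp Require Import all_boot all_order all_algebra.
From mathcomp Require Import complex.
From mathcomp Require Import all_classical all_reals all_analysis.
From mathcomp Require Import finmap ring lra.

Set Implicit Arguments.
Unset Strict Implicit.
Unset Printing Implicit Defensive.

Import Order.TTheory GRing.Theory Num.Theory.
Import numFieldNormedType.Exports.

Local Open Scope complex_scope.
Local Open Scope ring_scope.

(** The Schatten norm of a column operator [S] is the [l^p] norm of the
numbers [<X u, u>], [X = |S|], over the best finite orthonormal family [u]: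
for [X >= 0] and [p >= 1],
[[
  tr (X^p) = sup { sum_k <X u_k, u_k>^p : (u_k) finite orthonormal }.
]]
Only the half [tr (X^p) <= sup] is applied to the transformed tuple, and it
turns the operator inequality into a scalar Minkowski inequality.

- The half [<=] ([trace_power_le]): compress [X] to the Krylov space spanned by
  [X^k e], [k <= N], for finitely many basis vectors [e].  There [X] is a
  Hermitian matrix, and on those [e] every polynomial in [X] of degree at most
  [N] agrees with the same polynomial in the matrix ([spectral_quadrature]).
  As [t^p] is a uniform limit of polynomials, the partial sums of the trace
  are bounded by [sum_j l_j^p] up to an arbitrarily small error, where
  [l_j = <X u_j, u_j>] are the eigenvalues of the matrix.

- The partial isometry in the polar decomposition [S = W X] is approximated: a
  polynomial [g] with [0 <= t g(t) <= 1] and [t^2 g(t) >= t - e] on the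
  spectrum of [X] gives [W = S g(X)], which is a contraction with
  [<X u, u> - e <= Re <S u, W u>] ([polar_approx]).

- For [S_i = a V_i P + b P V_i], the term [Re <S u, W u>] splits into
  [a Re <P u, D u> + b sum_i Re <P V_i u, W_i u>] with the contraction
  [D = sum_i V_i^* W_i].  Since [P >= 0], each summand [Re <P x, y>] is at
  most [(<P x, x> + <P y, y>) / 2], so only numbers
  [sum_i <P C_i u, C_i u>] remain, with [sum_i |C_i x|^2 <= |x|^2] and one
  operator [C_i] in the first case, [d] in the second.

- By Jensen ([operator_jensen]) such a number to the power [p] is at most
  [sum_i <P^p C_i u, C_i u>], and summing over an orthonormal family costs at
  most [tr (P^p)] for each [C_i] ([trace_contraction]).  Hence the two [l^p]
  norms are at most [||T||] and [d^(1/p) ||T||], and Minkowski gives the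
  factor [a + b d^(1/p)] ([mean_power_sum]).

The adjoint, the square root and the real powers of a positive operator are
obtained from completeness: the adjoint from the Riesz representation, the
other two as limits of polynomials in the operator, with Bernstein
polynomials as explicit approximants. *)

(** * Real powers and polynomial approximation *)

Section RealPart.
Context {R : realType}.
Implicit Types (s t e M p : R) (f : R -> R).

Lemma invS_lt_eventually e : 0 < e ->
  exists N, forall n, (N <= n)%N -> n.+1%:R^-1 < e.
Proof.
move=> e0; exists (Num.truncn e^-1) => n Nn.
rewrite -[ltRHS]invrK ltf_pV2 ?posrE ?invr_gt0//.
by apply: lt_le_trans (truncnS_gt _) _; rewrite ler_nat ltnS.
Qed.

(** Young's inequality for the product of [t] and [s^(p-1)]: the graph of
[t^p] lies above its tangent at [s].  Tangent lines are polynomials of degree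
one, which is what makes the inequality usable under a functional calculus. *)
Lemma powR_tangent p s t : 1 <= p -> 0 <= s -> 0 <= t ->
  s `^ p + p * s `^ (p - 1) * (t - s) <= t `^ p.
Proof.
move=> p1 s0 t0; have p0 : 0 < p by lra.
have [->|pn1] := eqVneq p 1.
  by rewrite subrr powRr0 !powRr1//; lra.
have p1' : 0 < p - 1 by rewrite subr_gt0 lt_def pn1.
pose q := p / (p - 1).
have q0 : 0 < q by rewrite divr_gt0.
have pq : p^-1 + q^-1 = 1.
  by rewrite /q; field; rewrite !gt_eqF.
have := conjugate_powR t0 (powR_ge0 s (p - 1)) p0 q0 pq.
rewrite -powRrM (_ : (p - 1) * q = p); last first.
  by rewrite /q; field; rewrite gt_eqF.
rewrite (_ : q^-1 = 1 - p^-1); last by lra.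
have <- := mulr_powRB1 s0 p0.
move=> h; have := ler_wpM2l (ltW p0) h.
rewrite (_ : p * (_ + _) = t `^ p + s * s `^ (p - 1) * (p - 1)); first by lra.
by field; rewrite gt_eqF.
Qed.

Lemma powR_convex p (a b x y : R) : 1 <= p -> 0 <= a -> 0 <= b -> a + b = 1 ->
  0 <= x -> 0 <= y -> (a * x + b * y) `^ p <= a * x `^ p + b * y `^ p.
Proof.
move=> p1 a0 b0 ab x0 y0; set z := a * x + b * y.
have z0 : 0 <= z by rewrite addr_ge0// mulr_ge0.
have := ler_wpM2l a0 (powR_tangent p1 z0 x0).
have := ler_wpM2l b0 (powR_tangent p1 z0 y0).
set c := p * _; set d := z `^ p => hb ha.
have <- : a * (d + c * (x - z)) + b * (d + c * (y - z)) = d.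
  by rewrite (_ : b = 1 - a); [rewrite /z (_ : b = 1 - a); [ring|lra]|lra].
lra.
Qed.

(** A quadratic form of uniform continuity on the interval from [0] to [M]: it is
exactly what the variance bound for Bernstein polynomials consumes. *)
Definition quasi_lipschitz f M := forall e, 0 < e -> exists2 K, 0 <= K &
  forall s t, 0 <= s <= M -> 0 <= t <= M -> `|f s - f t| <= e + K * (s - t) ^+ 2.

Lemma sqrt_quasi_lipschitz M : quasi_lipschitz Num.sqrt M.
Proof.
move=> e e0; exists (e ^- 3); first by rewrite invr_ge0 exprn_ge0// ltW.
have main s t : 0 <= s -> s <= t ->
    Num.sqrt t - Num.sqrt s <= e + e ^- 3 * (s - t) ^+ 2.
  move=> s0 st; have t0 : 0 <= t by exact: le_trans st.
  have := sqr_sqrtr s0; have := sqr_sqrtr t0.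
  have : Num.sqrt s <= Num.sqrt t by rewrite ler_sqrt.
  have := sqrtr_ge0 s.
  set a := Num.sqrt s; set b := Num.sqrt t => a0 ab <- <-.
  have [h|h] := leP (b - a) e.
    by rewrite ler_wpDr// mulr_ge0 ?sqr_ge0// invr_ge0 exprn_ge0// ltW.
  rewrite ler_wpDl ?(ltW e0)// (mulrC (e ^- 3)) ler_pdivlMr ?exprn_gt0//.
  have h1 : e ^+ 3 <= (b - a) ^+ 3 by rewrite lerXn2r// ?nnegrE; lra.
  have h2 : (b - a) * e ^+ 3 <= (b - a) ^+ 4.
    by rewrite exprS ler_wpM2l//; lra.
  apply: (le_trans h2).
  rewrite (_ : _ ^+ 2 = (b - a) ^+ 2 * (b + a) ^+ 2); last by ring.
  rewrite (_ : _ ^+ 4 = (b - a) ^+ 2 * (b - a) ^+ 2); last by ring.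
  by rewrite ler_wpM2l ?sqr_ge0// lerXn2r// ?nnegrE; lra.
move=> s t /andP[s0 _] /andP[t0 _].
have [st|/ltW st] := leP s t.
  by rewrite distrC ger0_norm ?main// subr_ge0 ler_sqrt.
by rewrite -(opprB t) sqrrN ger0_norm ?main// subr_ge0 ler_sqrt.
Qed.

Lemma powR_quasi_lipschitz p M : 1 <= p -> quasi_lipschitz (fun t => t `^ p) M.
Proof.
move=> p1 e e0; set L := p * M `^ (p - 1).
have L0 : 0 <= L by rewrite mulr_ge0 ?powR_ge0//; lra.
exists (L ^+ 2 / (4 * e)); first by rewrite divr_ge0 ?sqr_ge0//; lra.
have main s t : 0 <= s <= M -> 0 <= t <= M ->
    t `^ p - s `^ p <= e + L ^+ 2 / (4 * e) * (s - t) ^+ 2.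
  move=> /andP[s0 sM] /andP[t0 tM].
  have h := powR_tangent p1 t0 s0.
  apply: (@le_trans _ _ (L * `|s - t|)).
    have h1 : p * t `^ (p - 1) <= L.
      by rewrite ler_wpM2l ?ge0_ler_powR// ?nnegrE//; lra.
    have h2 : p * t `^ (p - 1) * (t - s) <= p * t `^ (p - 1) * `|s - t|.
      apply: ler_wpM2l; last by rewrite distrC ler_norm.
      by rewrite mulr_ge0 ?powR_ge0 ?(le_trans ler01 p1).
    have h3 : p * t `^ (p - 1) * `|s - t| <= L * `|s - t| by rewrite ler_wpM2r.
    lra.
  rewrite -(real_normK (num_real (s - t))); set z := `|_|.
  have e4 : 0 < 4 * e by lra.
  have : 0 <= (4 * e)^-1 * (L * z - 2 * e) ^+ 2.
    by rewrite mulr_ge0 ?sqr_ge0// invr_ge0 ltW.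
  rewrite (_ : _ * _ ^+ 2 = e + L ^+ 2 / (4 * e) * z ^+ 2 - L * z); first by lra.
  by field; rewrite !gt_eqF.
move=> s t hs ht /=; have := main s t hs ht; have := main t s ht hs.
by rewrite -(opprB s t) sqrrN ler_norml; lra.
Qed.

(** The expectation of [g] under a binomial law of parameter [X], by
conditioning on one trial.  The recursion replaces binomial coefficients, so
the mean and the variance follow by induction. *)
Fixpoint bernstein (X : {poly R}) n (g : nat -> R) : {poly R} :=
  if n is n'.+1 then
    X * bernstein X n' (fun k => g k.+1) + (1 - X) * bernstein X n' g
  else (g 0)%:P.

Section BernsteinValue.
Variables (X : {poly R}) (t : R).
Notation x := X.[t].
Notation E n g := (bernstein X n g).[t].

Lemma bernsteinS n (g : nat -> R) : E n.+1 g = x * E n (fun k => g k.+1) + (1 - x) * E n g.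
Proof. by rewrite /= !hornerE. Qed.

Lemma bernsteinD n (g h : nat -> R) : E n (fun k => g k + h k) = E n g + E n h.
Proof.
elim: n g h => [|n IH] g h; first by rewrite /= !hornerE.
by rewrite !bernsteinS (IH (fun k => g k.+1)) IH; ring.
Qed.

Lemma bernsteinZ n a (g : nat -> R) : E n (fun k => a * g k) = a * E n g.
Proof.
elim: n g => [|n IH] g; first by rewrite /= !hornerE.
by rewrite !bernsteinS (IH (fun k => g k.+1)) IH; ring.
Qed.

Lemma bernstein_cst n a : E n (fun=> a) = a.
Proof.
elim: n => [|n IH]; first by rewrite /= !hornerE.
by rewrite !bernsteinS IH; ring.
Qed.

Lemma bernstein_mean n : E n (fun k => k%:R) = n%:R * x.
Proof.
elim: n => [|n IH]; first by rewrite /= !hornerE.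
rewrite bernsteinS (_ : (fun k => _) = (fun k => k%:R + 1)); last first.
  by apply/funext => k; rewrite -natr1.
by rewrite bernsteinD bernstein_cst IH -natr1; ring.
Qed.

Lemma bernstein_square n :
  E n (fun k => k%:R ^+ 2) = n%:R ^+ 2 * x ^+ 2 + n%:R * x * (1 - x).
Proof.
elim: n => [|n IH]; first by rewrite /= !hornerE expr0n/=; ring.
rewrite bernsteinS (_ : (fun k => _) = (fun k => (k%:R ^+ 2 + 2 * k%:R) + 1)).
  rewrite !bernsteinD bernsteinZ bernstein_cst bernstein_mean IH -natr1; ring.
by apply/funext => k; rewrite -natr1; ring.
Qed.

Lemma bernstein_le n (g h : nat -> R) : 0 <= x <= 1 -> (forall k, (k <= n)%N -> g k <= h k) ->
  E n g <= E n h.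
Proof.
move=> /andP[x0 x1]; elim: n g h => [|n IH] g h gh.
  by rewrite /= !hornerE gh.
rewrite !bernsteinS lerD// ler_wpM2l ?subr_ge0//; apply: IH => k kn.
  exact: gh.
by apply: gh; exact: leqW.
Qed.

Lemma bernstein_var n c : E n.+1 (fun k => (c * k%:R / n.+1%:R - c * x) ^+ 2)
  = c ^+ 2 * (x * (1 - x) / n.+1%:R).
Proof.
have nn : n.+1%:R != 0 :> R by rewrite pnatr_eq0.
rewrite (_ : (fun k => _) = (fun k => (c / n.+1%:R) ^+ 2 * k%:R ^+ 2 +
  ((- 2 * (c ^+ 2 / n.+1%:R * x)) * k%:R + c ^+ 2 * x ^+ 2))); last first.
  by apply/funext => k; field.
rewrite !bernsteinD !bernsteinZ bernstein_cst bernstein_mean bernstein_square.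
by field; rewrite addrC natr1.
Qed.

End BernsteinValue.

(** Weierstrass approximation.  Averaging [|f s - f t| <= e/2 + K (s - t)^2] over
the Bernstein weights leaves [e/2] plus [K] times the variance, which is
[O(1/n)]. *)
Lemma poly_approx f M : 0 < M -> quasi_lipschitz f M -> forall e, 0 < e ->
  exists q : {poly R}, forall t, 0 <= t <= M -> `|q.[t] - f t| <= e.
Proof.
move=> M0 qf e e0; have e20 : 0 < e / 2 by lra.
have [K K0 fK] := qf _ e20.
(* the variance of [M k / n.+1] is at most [M^2 / n.+1] *)
pose n := Num.truncn (2 * K * M ^+ 2 / e).
have nK : K * M ^+ 2 / n.+1%:R <= e / 2.
  rewrite ler_pdivrMr ?ltr0n//.
  have : 2 * K * M ^+ 2 / e < n.+1%:R by rewrite /n truncnS_gt.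
  by rewrite ltr_pdivrMr//; lra.
pose X : {poly R} := M^-1 *: 'X.
pose g k := f (M * k%:R / n.+1%:R).
exists (bernstein X n.+1 g) => t /andP[t0 tM].
have Xt : X.[t] = t / M by rewrite /X !hornerE mulrC.
have x01 : 0 <= X.[t] <= 1.
  by rewrite Xt divr_ge0 ?(ltW M0)//= ler_pdivrMr ?mul1r.
have tE : t = M * X.[t] by rewrite Xt; field; rewrite gt_eqF.
pose B k := e / 2 + K * (M * k%:R / n.+1%:R - M * X.[t]) ^+ 2.
have EB : (bernstein X n.+1 B).[t] <= e.
  rewrite bernsteinD bernstein_cst bernsteinZ bernstein_var.
  have : X.[t] * (1 - X.[t]) <= 1 by nra.
  set w := X.[t] * _ => w1.
  have -> : K * (M ^+ 2 * (w / n.+1%:R)) = K * M ^+ 2 / n.+1%:R * w by ring.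
  have : K * M ^+ 2 / n.+1%:R * w <= K * M ^+ 2 / n.+1%:R.
    by rewrite ler_piMr// divr_ge0// mulr_ge0 ?sqr_ge0.
  by move: nK; set c := K * _ / _; lra.
have gB k : (k <= n.+1)%N -> `|g k - f t| <= B k.
  move=> kn; rewrite /B -tE; apply: fK; last by rewrite t0.
  rewrite divr_ge0 ?mulr_ge0 ?(ltW M0)//= -mulrA ler_piMr ?(ltW M0)//.
  by rewrite ler_pdivrMr ?ltr0n// mul1r ler_nat.
rewrite ler_norml; apply/andP; split.
  have : (bernstein X n.+1 (fun k => f t + (- 1) * B k)).[t] <=
         (bernstein X n.+1 g).[t].
    by apply: bernstein_le => // k /gB; rewrite ler_norml => /andP[+ _]; lra.
  by rewrite bernsteinD bernsteinZ bernstein_cst; lra.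
have : (bernstein X n.+1 g).[t] <= (bernstein X n.+1 (fun k => f t + B k)).[t].
  by apply: bernstein_le => // k /gB; rewrite ler_norml => /andP[_ +]; lra.
by rewrite bernsteinD bernstein_cst; lra.
Qed.

(** With [y = 1 - t/M], the truncated geometric series [g = (1 - y^n) / t] works:
[t g = 1 - y^n], and [t - t^2 g = M (1 - y) y^n <= M / (n + 1)] because
[(n + 1) y^n] is at most [1 + y + ... + y^n]. *)
Lemma approx_inverse M e : 0 < M -> 0 < e -> exists g : {poly R},
  forall t, 0 <= t <= M -> [/\ 0 <= t * g.[t], t * g.[t] <= 1 &
    t - e <= t ^+ 2 * g.[t]].
Proof.
move=> M0 e0; pose n := Num.truncn (M / e).
have ne : M / n.+1%:R <= e.
  rewrite ler_pdivrMr ?ltr0n//.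
  have : M / e < n.+1%:R by rewrite /n truncnS_gt.
  by rewrite ltr_pdivrMr//; lra.
pose Y : {poly R} := 1 - M^-1 *: 'X.
exists (M^-1 *: \sum_(k < n) Y ^+ k) => t /andP[t0 tM].
pose y := 1 - t / M.
have Yt : Y.[t] = y by rewrite /Y /y !hornerE mulrC.
have y01 : 0 <= y <= 1.
  have : t / M <= 1 by rewrite ler_pdivrMr ?mul1r.
  have : 0 <= t / M by rewrite divr_ge0// ltW.
  by rewrite /y; lra.
have /andP[y0 y1] := y01.
have tE : t = M * (1 - y) by rewrite /y; field; rewrite gt_eqF.
have gE : t * (M^-1 *: \sum_(k < n) Y ^+ k).[t] = 1 - y ^+ n.
  rewrite hornerZ horner_sum (eq_bigr (fun k : 'I_n => y ^+ k)); last first.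
    by move=> k _; rewrite horner_exp Yt.
  rewrite {1}tE -[in RHS](opprB (y ^+ n)) subrX1.
  by field; rewrite gt_eqF.
have yn01 : 0 <= y ^+ n <= 1 by rewrite exprn_ge0//= exprn_ile1.
split; rewrite ?gE; [lra|lra|].
rewrite expr2 -mulrA gE mulrBr mulr1 lerD2l lerN2; apply: le_trans ne.
rewrite tE -mulrA ler_wpM2l ?(ltW M0)// -[X in X <= _](@mulrK _ n.+1%:R) ?unitfE ?pnatr_eq0//.
rewrite ler_piMl ?invr_ge0//.
have : y ^+ n * n.+1%:R <= \sum_(k < n.+1) y ^+ k.
  rewrite mulr_natr -[X in _ *+ X]card_ord -sumr_const; apply: ler_sum => k _.
  by apply: ler_wiXn2l => //; rewrite -ltnS.
move=> /(ler_wpM2l (_ : 0 <= 1 - y)); rewrite subr_ge0 => /(_ y1).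
have -> : (1 - y) * \sum_(k < n.+1) y ^+ k = 1 - y ^+ n.+1.
  by rewrite -[in RHS](opprB (y ^+ n.+1)) subrX1; ring.
have := exprn_ge0 n.+1 y0; lra.
Qed.

End RealPart.

(** * Complex numbers and linear maps *)

Section Complex.
Context {R : realType}.
Implicit Types (z w : R[i]) (a : R).
Local Notation Re := complex.Re.

(** The squared modulus, as an element of [R]. *)
Definition csq z : R := Re (z * Num.conj z).

Lemma csqE z : (csq z)%:C = z * Num.conj z.
Proof.
rewrite /csq; case: z => a b.
by rewrite /Num.conj/=; congr Complex; rewrite /=; ring.
Qed.

Lemma csqRI z : csq z = Re z ^+ 2 + complex.Im z ^+ 2.
Proof. by case: z => a b; rewrite /csq/=; ring. Qed.

Lemma csq_ge0 z : 0 <= csq z.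
Proof. by rewrite csqRI addr_ge0 ?sqr_ge0. Qed.

Lemma csq_eq0 z : csq z = 0 -> z = 0.
Proof.
by move=> /(congr1 (real_complex R)); rewrite csqE => /eqP; rewrite mul_conjC_eq0 => /eqP.
Qed.

Lemma csqM z w : csq (z * w) = csq z * csq w.
Proof. by case: z => a b; case: w => c d; rewrite !csqRI/=; ring. Qed.

Lemma csqD_le z w : csq (z + w) <= 2 * csq z + 2 * csq w.
Proof.
case: z => a b; case: w => c d; rewrite !csqRI/= -subr_ge0.
rewrite [leRHS](_ : _ = (a - c) ^+ 2 + (b - d) ^+ 2); last by ring.
by rewrite addr_ge0 ?sqr_ge0.
Qed.

Lemma csq_conj z : csq (Num.conj z) = csq z.
Proof. by case: z => a b; rewrite !csqRI/=; ring. Qed.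

Lemma csqR a : csq a%:C = a ^+ 2.
Proof. by rewrite csqRI/=; ring. Qed.

Lemma ReD z w : Re (z + w) = Re z + Re w.
Proof. by case: z; case: w. Qed.
Lemma ReN z : Re (- z) = - Re z.
Proof. by case: z. Qed.
Lemma ReB z w : Re (z - w) = Re z - Re w.
Proof. by rewrite ReD ReN. Qed.
Lemma ReC z : Re (Num.conj z) = Re z.
Proof. by case: z. Qed.
Lemma ReZ a z : Re (a%:C * z) = a * Re z.
Proof. by case: z => b c /=; ring. Qed.
Lemma Re_sum I (r : seq I) (P : pred I) (F : I -> R[i]) :
  Re (\sum_(i <- r | P i) F i) = \sum_(i <- r | P i) Re (F i).
Proof. by elim/big_rec2: _ => // i x z _ <-; rewrite ReD. Qed.
Lemma conjRC a : Num.conj (a%:C : R[i]) = a%:C.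
Proof. by rewrite /Num.conj/= oppr0. Qed.
Lemma conjM z w : Num.conj (z * w) = Num.conj z * Num.conj w.
Proof. exact: rmorphM. Qed.
Lemma sumC I (r : seq I) (P : pred I) (F : I -> R) :
  (\sum_(i <- r | P i) F i)%:C = \sum_(i <- r | P i) (F i)%:C.
Proof. by rewrite raddf_sum. Qed.
Lemma CM a b : (a * b)%:C = a%:C * b%:C :> R[i].
Proof. by rewrite rmorphM. Qed.

End Complex.

Section LinearMaps.
Context {K : pzRingType} {U V : lmodType K} (A : U -> V).
Hypothesis linA : linear A.

Lemma lin0 : A 0 = 0.
Proof. by have := linA (-1) 0 0; rewrite scaler0 addr0 scaleN1r addNr. Qed.
Lemma linD x y : A (x + y) = A x + A y.
Proof. by have := linA 1 x y; rewrite !scale1r. Qed.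
Lemma linZ a x : A (a *: x) = a *: A x.
Proof. by have := linA a x 0; rewrite !addr0 lin0 addr0. Qed.
Lemma linB x y : A (x - y) = A x - A y.
Proof. by rewrite -scaleN1r linD linZ scaleN1r. Qed.
Lemma lin_sum I (r : seq I) (P : pred I) (F : I -> U) :
  A (\sum_(i <- r | P i) F i) = \sum_(i <- r | P i) A (F i).
Proof. exact: (big_morph A linD lin0). Qed.
End LinearMaps.

(** * Inner product *)

Section Hilbert.
Context {R : realType} {H : completeNormedModType R[i]}.
Variable dot : {dot H for (@Num.conj R[i])}.
Hypothesis dot_norm : induces_norm dot.
Local Notation Re := complex.Re.
Implicit Types (x y z v : H) (a b : R[i]).

Lemma dotC x y : dot x y = Num.conj (dot y x).
Proof. by rewrite [LHS]hermC expr0 mul1r. Qed.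
Lemma dotDl x y z : dot (x + y) z = dot x z + dot y z.
Proof. exact: linearDl. Qed.
Lemma dotDr x y z : dot x (y + z) = dot x y + dot x z.
Proof. exact: linearDr. Qed.
Lemma dotBl x y z : dot (x - y) z = dot x z - dot y z.
Proof. exact: linearBl. Qed.
Lemma dotBr x y z : dot x (y - z) = dot x y - dot x z.
Proof. exact: linearBr. Qed.
Lemma dotZl a x y : dot (a *: x) y = a * dot x y.
Proof. exact: linearZl_LR. Qed.
Lemma dotZr a x y : dot x (a *: y) = Num.conj a * dot x y.
Proof. exact: linearZr_LR. Qed.
Lemma dot0l x : dot 0 x = 0.
Proof. exact: linear0l. Qed.
Lemma dot0r x : dot x 0 = 0.
Proof. exact: linear0r. Qed.
Lemma dot_suml I (r : seq I) (P : pred I) (F : I -> H) y :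
  dot (\sum_(i <- r | P i) F i) y = \sum_(i <- r | P i) dot (F i) y.
Proof. exact: linear_sumlz. Qed.
Lemma dot_sumr I (r : seq I) (P : pred I) (F : I -> H) x :
  dot x (\sum_(i <- r | P i) F i) = \sum_(i <- r | P i) dot x (F i).
Proof. exact: linear_sumr. Qed.

Definition sqnorm x : R := Re (dot x x).
Local Notation nsq := sqnorm.

Lemma sqnormE x : dot x x = (nsq x)%:C.
Proof.
rewrite /sqnorm; have := dnorm_ge0 dot x; case: (dot x x) => a b.
by rewrite lecE/= => /andP[/eqP -> _].
Qed.

Lemma sqnorm_ge0 x : 0 <= nsq x.
Proof. by have := dnorm_ge0 dot x; rewrite sqnormE ler0c. Qed.

Lemma sqnorm_eq0 x : nsq x = 0 -> x = 0.
Proof. by move=> h; apply/eqP; rewrite -(dnorm_eq0 dot) sqnormE h. Qed.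

Lemma sqnorm0 : nsq 0 = 0.
Proof. by rewrite /sqnorm dot0l. Qed.

Lemma sqnormZ a x : nsq (a *: x) = csq a * nsq x.
Proof. by rewrite {1}/sqnorm dotZl dotZr mulrA -csqE sqnormE ReZ. Qed.

Lemma sqnormN x : nsq (- x) = nsq x.
Proof. by rewrite -scaleN1r sqnormZ csqRI/=; ring. Qed.

Lemma sqnormBC x y : nsq (x - y) = nsq (y - x).
Proof. by rewrite -sqnormN opprB. Qed.

Lemma sqnormD x y : nsq (x + y) = nsq x + nsq y + 2 * Re (dot x y).
Proof.
rewrite /sqnorm dotDl !dotDr !ReD (dotC y x) ReC; ring.
Qed.

Lemma sqnormB x y : nsq (x - y) = nsq x + nsq y - 2 * Re (dot x y).
Proof.
by rewrite sqnormD sqnormN -scaleN1r dotZr rmorphN rmorph1 mulN1r ReN; ring.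
Qed.

Lemma normE x : `|x| = (Num.sqrt (nsq x))%:C.
Proof.
apply/eqP; rewrite -(@eqrXn2 _ 2)// ?ler0c ?sqrtr_ge0//.
by rewrite dot_norm sqnormE -rmorphXn/= sqr_sqrtr ?sqnorm_ge0.
Qed.

Lemma norm_lt x (e : R) : 0 < e -> (`|x| < e%:C) = (nsq x < e ^+ 2).
Proof.
move=> e0; rewrite normE ltcR -[in RHS](sqr_sqrtr (sqnorm_ge0 x)).
by rewrite ltr_pXn2r// nnegrE ?sqrtr_ge0// ltW.
Qed.

Lemma norm_le x (e : R) : 0 <= e -> (`|x| <= e%:C) = (nsq x <= e ^+ 2).
Proof.
move=> e0; rewrite normE lecR -[in RHS](sqr_sqrtr (sqnorm_ge0 x)).
by rewrite ler_pXn2r// nnegrE ?sqrtr_ge0.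
Qed.

(** Cauchy-Schwarz, from the nonnegativity of the squared norm of
[<y,y> x - <x,y> y]. *)
Lemma dot_csq x y : csq (dot x y) <= nsq x * nsq y.
Proof.
have [y0|yn0] := eqVneq (nsq y) 0.
  by rewrite y0 (sqnorm_eq0 y0) dot0r csqRI/= mulr0 expr0n/= addr0.
have y0 : 0 < nsq y by rewrite lt_def yn0 sqnorm_ge0.
set c := dot x y.
have := sqnorm_ge0 ((nsq y)%:C *: x - c *: y).
rewrite sqnormB !sqnormZ dotZl dotZr -/c csqR mulrC.
rewrite (mulrC (Num.conj c)) -csqE -CM /= => h.
have : 0 <= nsq y * (nsq x * nsq y - csq c) by rewrite [leRHS](_ : _ =
  nsq x * nsq y ^+ 2 + csq c * nsq y - 2 * (nsq y * csq c)); [exact: h|ring].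
by rewrite pmulr_rge0// subr_ge0.
Qed.

Definition hlim (u : nat -> H) y := forall e : R, 0 < e ->
  exists N, forall n, (N <= n)%N -> nsq (y - u n) < e.

(** Completeness of the space restated with the real-valued squared norm, so that
later limits avoid the complex-valued norm. *)
Lemma hcomplete (u : nat -> H) :
  (forall e : R, 0 < e -> exists N, forall n k, (N <= n)%N -> (N <= k)%N ->
     nsq (u n - u k) < e) -> exists y, hlim u y.
Proof.
move=> cu.
have : cvg (u @ \oo)%classic.
  apply/cauchy_cvgP/cauchy_ballP => e e0.
  have eE : e = (Re e)%:C by move: e0; case: e => a b; rewrite ltcE/= => /andP[/eqP -> _].
  have re0 : 0 < Re e by move: e0; rewrite eE ltcR.
  have [N uN] := cu (Re e ^+ 2) (exprn_gt0 _ re0).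
  exists ((u @` [set n | (N <= n)%N])%classic, (u @` [set n | (N <= n)%N])%classic).
    by split; exists N => // n /= Nn; exists n.
  move=> [_ _] /= [[n Nn <-] [k Nk <-]].
  by rewrite -ball_normE/= eE norm_lt// uN.
move=> /cvg_ex[y uy]; exists y => e e0.
move/cvgrPdist_lt : uy => /(_ (Num.sqrt e)%:C).
rewrite ltcR sqrtr_gt0 => /(_ e0) [N _ uN]; exists N => n Nn.
by have := uN n Nn; rewrite norm_lt ?sqrtr_gt0// sqr_sqrtr ?ltW.
Qed.

End Hilbert.

(** * Projection, Riesz representation and adjoints *)

Section Hilbert2.
Context {R : realType} {H : completeNormedModType R[i]}.
Variable dot : {dot H for (@Num.conj R[i])}.
Hypothesis dot_norm : induces_norm dot.
Local Notation Re := complex.Re.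
Local Notation nsq := (sqnorm dot).
Implicit Types (x y z v : H) (a b : R[i]) (A B : H -> H).

Lemma eq0_of_all_eps (c d : R) : 0 <= c -> 0 <= d ->
  (forall e, 0 < e -> d <= c * e) -> d = 0.
Proof.
move=> c0 d0 h; apply/eqP; rewrite eq_le d0 andbT leNgt; apply/negP => dp.
have c1 : 0 < 2 * (c + 1) by lra.
have := h (d / (2 * (c + 1))) (divr_gt0 dp c1).
rewrite mulrA ler_pdivlMr//; nra.
Qed.

(** Approximate first-order condition: if [0] is almost the best multiple of [v]
to subtract from [z], then [z] is almost orthogonal to [v]. *)
Lemma best_scalar z v (e : R) : 0 <= e ->
  (forall c, nsq z - e <= nsq (z - c *: v)) -> csq (dot z v) <= e * nsq v.
Proof.
move=> e0 h.
have [v0|vn0] := eqVneq (nsq v) 0.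
  by rewrite v0 (sqnorm_eq0 v0) dot0r csqRI/= mulr0 expr0n/= addr0.
have v0 : 0 < nsq v by rewrite lt_def vn0 sqnorm_ge0.
set d := dot z v; have := h ((nsq v)^-1%:C * d).
rewrite sqnormB sqnormZ csqM csqR dotZr conjM conjRC -/d -[X in Re X]mulrA ReZ.
rewrite (mulrC (Num.conj d)) -csqE /= => k.
have : 0 <= e - csq d / nsq v.
  rewrite [leRHS](_ : _ = ((nsq v)^-1 ^+ 2 * csq d * nsq v -
    2 * ((nsq v)^-1 * csq d)) + e); last by field; rewrite gt_eqF.
  lra.
by rewrite subr_ge0 ler_pdivrMr.
Qed.

(** A minimizing sequence in the subspace [K] is Cauchy by the parallelogram law,
and its limit [y] has a residual orthogonal to [K] by [best_scalar].  The limit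
lies in the closure of [K], hence the approximation clause. *)
Lemma orthogonal_projection (K : set H) x : K 0 ->
  (forall a u v, K u -> K v -> K (a *: u + v)) ->
  exists y, (forall e : R, 0 < e -> exists2 m, K m & nsq (y - m) < e) /\
    forall m, K m -> dot (x - y) m = 0.
Proof.
move=> K0 KP.
pose S := [set nsq (x - m) | m in K]%classic.
have hS : has_inf S.
  by split; [exists (nsq (x - 0)), 0 | exists 0 => _ [m _ <-]; exact: sqnorm_ge0].
pose D := inf S.
have D_le m : K m -> D <= nsq (x - m).
  by move=> Km; apply: ge_inf => //; [exact: hS.2 | exists m].
have min_ex (n : nat) : exists m, K m /\ nsq (x - m) < D + n.+1%:R^-1.
  have : 0 < n.+1%:R^-1 :> R by rewrite invr_gt0 ltr0n.
  by move=> /inf_adherent/(_ hS)[_ [m Km <-] mn]; exists m.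
have /choice[u uP] := min_ex.
have Ku n : K (u n) by have [] := uP n.
have small (e : R) : 0 < e -> exists N, forall n, (N <= n)%N ->
    nsq (x - u n) < D + e.
  move=> /invS_lt_eventually[N hN]; exists N => n /hN Nn.
  by apply: lt_trans (uP n).2 _; rewrite ltrD2l.
have [y uy] : exists y, hlim dot u y.
  apply: (hcomplete dot_norm) => e e0.
  have e4 : 0 < e / 4 by lra.
  have [N uN] := small _ e4; exists N => n k /uN hn /uN hk.
  have Kh : K (2^-1 *: u n + 2^-1 *: u k).
    by apply: (KP) => //; rewrite -[_ *: _]addr0; exact: (KP).
  have := D_le _ Kh.
  have -> : x - (2^-1 *: u n + 2^-1 *: u k) =
      2^-1 *: ((x - u n) + (x - u k)).
    rewrite [in RHS]addrACA -opprD scalerBr (scalerDr _ (u n)); congr (_ - _).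
    have -> : x + x = (2 : R[i]) *: x by rewrite scaler_nat mulr2n.
    by rewrite scalerA mulVf ?scale1r ?pnatr_eq0.
  rewrite sqnormZ (_ : csq 2^-1 = 4^-1); last first.
    have -> : (2^-1 : R[i]) = (2^-1)%:C by rewrite fmorphV rmorph_nat.
    by rewrite csqR; field.
  have -> : nsq (u n - u k) = nsq ((x - u n) - (x - u k)).
    by rewrite sqnormBC [in RHS]opprB [in RHS]addrC [in RHS]addrA subrK.
  rewrite (sqnormB _ (x - u n)) (sqnormD _ (x - u n)); lra.
exists y; split.
  move=> e e0; have [N uN] := uy e e0; exists (u N) => //; exact: uN.
move=> m Km; apply: csq_eq0; apply: (@eq0_of_all_eps (4 * nsq m)).
- by rewrite mulr_ge0 ?sqnorm_ge0.
- exact: csq_ge0.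
move=> e e0.
have [N1 h1] := small e e0; have [N2 h2] := uy e e0.
pose n := maxn N1 N2.
have : csq (dot (x - u n) m) <= e * nsq m.
  apply: best_scalar; first exact: ltW.
  move=> c; have := D_le _ (KP c _ _ Km (Ku n)).
  rewrite opprD (addrC (- (c *: m))) addrA.
  have := h1 n (leq_maxl _ _); lra.
have : csq (dot (u n - y) m) <= e * nsq m.
  apply: le_trans (dot_csq _ _ _) _; rewrite ler_wpM2r ?sqnorm_ge0// sqnormBC.
  by apply/ltW/h2; exact: leq_maxr.
have -> : x - y = (x - u n) + (u n - y) by rewrite addrA subrK.
rewrite -mulrA (mulrC (nsq m)); set k := e * _ => h1' h2'.
by rewrite dotDl; apply: le_trans (csqD_le _ _) _; lra.
Qed.

(** The vector is a multiple of the component of some [x0], [f x0 <> 0],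
orthogonal to the kernel of [f]; the bound on [f] puts the limit of kernel
elements back in the kernel. *)
Lemma riesz_representation (f : H -> R[i]) (c : R) : 0 <= c ->
  (forall a u v, f (a *: u + v) = a * f u + f v) ->
  (forall x, csq (f x) <= c * nsq x) -> exists z, forall x, f x = dot x z.
Proof.
move=> c0 linf fc.
have f0 : f 0 = 0.
  by have := linf (-1) 0 0; rewrite scaler0 addr0 mulN1r addNr.
have fB u v : f (u - v) = f u - f v.
  by rewrite addrC -scaleN1r linf mulN1r addrC.
have [fz|/existsNP[x0 fx0]] := pselect (forall x, f x = 0).
  by exists 0 => x; rewrite fz dot0r.
have [|a u v fu fv|y [yK yo]] := @orthogonal_projection [set v | f v = 0]%classic x0.
- exact: f0.
- by rewrite /= linf fu fv mulr0 addr0.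
have fy : f y = 0.
  apply: csq_eq0; apply: (@eq0_of_all_eps c) => //; first exact: csq_ge0.
  move=> e /yK[m fm ym]; rewrite -[f y]subr0 -fm -fB.
  by apply: le_trans (fc _) _; rewrite ler_wpM2l// ltW.
set w := x0 - y in yo.
have fw : f w != 0 by rewrite /w fB fy subr0; exact/eqP.
have wn0 : dot w w != 0.
  by rewrite dnorm_eq0; apply: contra fw => /eqP->; rewrite f0.
exists (Num.conj (f w / dot w w) *: w) => x.
rewrite dotZr conjCK.
have : dot w (x - (f x / f w) *: w) = 0.
  apply: yo; rewrite /= fB -[_ *: w]addr0 linf f0 addr0 divfK ?subrr//.
rewrite dotC => /(congr1 Num.conj); rewrite conjCK rmorph0 dotBl dotZl.
by move=> /eqP; rewrite subr_eq0 => /eqP ->; field; rewrite fw wn0.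
Qed.

Lemma dot_inj u v : (forall x, dot x u = dot x v) -> u = v.
Proof.
by move=> h; apply/eqP; rewrite -subr_eq0 -(dnorm_eq0 dot) dotBr h subrr.
Qed.

Lemma bounded_opP A : bounded_op A ->
  exists2 c : R, 0 <= c & forall x, nsq (A x) <= c * nsq x.
Proof.
move=> [linA contA].
pose L : {linear H -> H} := HB.pack A (GRing.isLinear.Build _ _ _ _ A linA).
have /linear_boundedP/pinfty_ex_gt0[r r0 Lr] : bounded_near L (nbhs (0 : H)).
  by apply/linear_bounded_continuous.
have rE : r = (Re r)%:C by move: r0; case: (r) => a b; rewrite ltcE/= => /andP[/eqP -> _].
exists (Re r ^+ 2); first exact: sqr_ge0.
move=> x; have := Lr x; rewrite !(normE dot_norm) rE -CM lecR => h.
have : Num.sqrt (nsq (A x)) ^+ 2 <= (Re r * Num.sqrt (nsq x)) ^+ 2.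
  by rewrite lerXn2r// nnegrE ?sqrtr_ge0// (le_trans _ h)// sqrtr_ge0.
by rewrite exprMn !sqr_sqrtr ?sqnorm_ge0.
Qed.

Lemma bounded_opI A (c : R) : linear A -> 0 <= c ->
  (forall x, nsq (A x) <= c * nsq x) -> bounded_op A.
Proof.
move=> linA c0 Ac; split=> //.
pose L : {linear H -> H} := HB.pack A (GRing.isLinear.Build _ _ _ _ A linA).
apply/(@linear_bounded_continuous _ _ _ L)/ex_bound.
exists (Num.sqrt c)%:C; apply/nbhs_norm0P; exists 1 => //= x /= x1.
rewrite (norm_le dot_norm) ?sqrtr_ge0// sqr_sqrtr//.
have : nsq x <= 1 by rewrite -(expr1n _ 2) -(norm_le dot_norm) ?ltW.
have := Ac x; nra.
Qed.

Lemma adjoint_exists A : bounded_op A ->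
  exists B, bounded_op B /\ forall x y, dot (A x) y = dot x (B y).
Proof.
move=> bA; have linA := bA.1; have [c c0 Ac] := bounded_opP bA.
have ex y : exists z, forall x, dot (A x) y = dot x z.
  apply: (@riesz_representation _ (c * nsq y)); first by rewrite mulr_ge0 ?sqnorm_ge0.
    by move=> a u v; rewrite linA dotDl dotZl.
  move=> x; apply: le_trans (dot_csq _ _ _) _.
  by rewrite mulrAC ler_wpM2r ?sqnorm_ge0.
have /choice[B BP] := ex; exists B; split; last by move=> x y; exact: BP.
apply: (@bounded_opI _ c) => //.
  move=> a u v; apply: dot_inj => x.
  by rewrite -BP !dotDr !dotZr !BP.
move=> y; have [->|By] := eqVneq (nsq (B y)) 0; first by rewrite mulr_ge0 ?sqnorm_ge0.
have By0 : 0 < nsq (B y) by rewrite lt_def By sqnorm_ge0.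
have : csq (dot (B y) (B y)) <= c * nsq (B y) * nsq y.
  rewrite -BP; apply: le_trans (dot_csq _ _ _) _.
  by rewrite ler_wpM2r ?sqnorm_ge0.
by rewrite sqnormE csqR mulrAC expr2 ler_pM2r.
Qed.

Lemma adjointP A : bounded_op A ->
  bounded_op (adjoint dot A) /\ forall x y, dot (A x) y = dot x (adjoint dot A y).
Proof.
move=> /adjoint_exists ex.
by have := xgetPex (0 : H -> H) ex.
Qed.

(** Polarization: the form of [A] is real on the diagonal, and evaluating it at
[x + y] and [x + i y] recovers [<A x, y>]. *)
Lemma positive_selfadjoint A : positive_op dot A -> forall x y, dot (A x) y = dot x (A y).
Proof.
move=> [[linA _] posA].
have sym x : dot (A x) x = dot x (A x).
  rewrite [RHS]dotC; have := posA x; case: (dot (A x) x) => a b.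
  by rewrite lecE/= => /andP[/eqP-> _]; rewrite /Num.conj/= oppr0.
move=> x y.
have h1 := sym (x + y); have h2 := sym (x + 'i *: y).
rewrite !(linD linA) !(linZ linA) !dotDl !dotDr !dotZl !dotZr !sym in h1 h2.
have {}h1 : dot (A x) y + dot (A y) x = dot x (A y) + dot y (A x).
  apply: (addrI (dot x (A x))); apply: (addIr (dot y (A y))).
  by move: h1; rewrite !addrA => h1; rewrite -h1; ring.
have {}h2 : dot (A y) x - dot (A x) y = dot y (A x) - dot x (A y).
  have ci : Num.conj ('i : R[i]) = - 'i by rewrite /Num.conj/= ; congr Complex; rewrite ?oppr0.
  have i0 : ('i : R[i]) != 0 by rewrite eq_complex/= oner_eq0 andbF.
  apply: (mulfI i0); apply: (addrI (dot x (A x))).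
  apply: (addIr ('i * (- 'i * dot y (A y)))).
  move: h2; rewrite !ci => h2.
  transitivity (dot x (A x) + - 'i * dot (A x) y +
    ('i * dot (A y) x + 'i * (- 'i * dot y (A y)))); first ring.
  by rewrite h2; ring.
have : 2 * dot (A x) y = 2 * dot x (A y).
  transitivity ((dot (A x) y + dot (A y) x) - (dot (A y) x - dot (A x) y)); first ring.
  by rewrite h1 h2; ring.
by apply: mulfI; rewrite pnatr_eq0.
Qed.

End Hilbert2.

(** * Orthonormal families and Krylov diagonalization *)

Section Hilbert3.
Context {R : realType} {H : completeNormedModType R[i]}.
Variable dot : {dot H for (@Num.conj R[i])}.
Hypothesis dot_norm : induces_norm dot.
Local Notation Re := complex.Re.
Local Notation nsq := (sqnorm dot).
Implicit Types (x y z v : H) (a b : R[i]) (A B : H -> H).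

Lemma opnorm_set A : bounded_op A ->
  has_sup [set Re `|A x| | x in [set x : H | `|x| <= 1]]%classic.
Proof.
move=> bA; have [c c0 Ac] := bounded_opP dot_norm bA; split.
  by exists (Re `|A 0|), 0 => //=; rewrite normr0.
exists (Num.sqrt c) => _ [x /= x1 <-]; rewrite (normE dot_norm) /= ler_sqrt//.
have : nsq x <= 1 by rewrite -(expr1n _ 2) -(norm_le dot_norm).
have := Ac x; nra.
Qed.

Lemma opnorm_ge0 A : bounded_op A -> 0 <= opnorm A.
Proof.
move=> bA; apply: le_trans (_ : Re `|A 0| <= _).
  by rewrite (normE dot_norm)/= sqrtr_ge0.
apply: ub_le_sup; first exact: (opnorm_set bA).2.
by exists 0 => //=; rewrite normr0.
Qed.

Lemma opnorm_bound A x : bounded_op A -> nsq (A x) <= opnorm A ^+ 2 * nsq x.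
Proof.
move=> bA; have linA := bA.1.
have [x0|xn0] := eqVneq (nsq x) 0.
  by rewrite x0 (sqnorm_eq0 x0) (lin0 linA) sqnorm0 mulr0.
have x0 : 0 < nsq x by rewrite lt_def xn0 sqnorm_ge0.
pose c := (Num.sqrt (nsq x))^-1; have c2 : c ^+ 2 = (nsq x)^-1.
  by rewrite exprVn sqr_sqrtr ?ltW.
have : Re `|A (c%:C *: x)| <= opnorm A.
  apply: ub_le_sup; first exact: (opnorm_set bA).2.
  exists (c%:C *: x) => //=; rewrite (norm_le dot_norm)// sqnormZ csqR c2.
  by rewrite mulVf// expr1n.
rewrite (normE dot_norm)/= (linZ linA) sqnormZ csqR c2 => h.
have : Num.sqrt ((nsq x)^-1 * nsq (A x)) ^+ 2 <= opnorm A ^+ 2.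
  by rewrite ler_pXn2r// nnegrE ?sqrtr_ge0// opnorm_ge0.
by rewrite sqr_sqrtr ?mulr_ge0 ?invr_ge0 ?sqnorm_ge0// mulrC ler_pdivrMr.
Qed.

Lemma opnorm_le A (e : R) : 0 <= e -> (forall x, nsq (A x) <= e ^+ 2 * nsq x) ->
  opnorm A <= e.
Proof.
move=> e0 h; apply: ge_sup.
  by exists (Re `|A 0|), 0 => //=; rewrite normr0.
move=> _ [x /= x1 <-]; rewrite (normE dot_norm)/=.
have : nsq x <= 1 by rewrite -(expr1n _ 2) -(norm_le dot_norm).
move=> {}x1; rewrite -(ger0_norm e0) -sqrtr_sqr ler_sqrt ?sqr_ge0//.
by apply: le_trans (h x) _; rewrite ler_piMr ?sqr_ge0.
Qed.

(** Finite orthonormal families are functions on an ordinal, since only sums over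
them are needed. *)
Definition orthonormal_fam m (u : 'I_m -> H) :=
  forall i j, dot (u i) (u j) = (i == j)%:R.

Definition expansion m (u : 'I_m -> H) x := \sum_j dot x (u j) *: u j.

Section Family.
Variables (m : nat) (u : 'I_m -> H).
Hypothesis onu : orthonormal_fam u.

Lemma dot_comb (c : 'I_m -> R[i]) k : dot (\sum_j c j *: u j) (u k) = c k.
Proof.
rewrite dot_suml (bigD1 k)//= dotZl onu eqxx mulr1 big1 ?addr0// => j jk.
by rewrite dotZl onu (negbTE jk) mulr0.
Qed.

Lemma dot_comb2 (c d : 'I_m -> R[i]) :
  dot (\sum_j c j *: u j) (\sum_j d j *: u j) = \sum_j c j * Num.conj (d j).
Proof.
rewrite dot_sumr; apply: eq_bigr => j _.
by rewrite dotZr dot_comb mulrC.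
Qed.

Lemma sqnorm_comb (c : 'I_m -> R[i]) : nsq (\sum_j c j *: u j) = \sum_j csq (c j).
Proof.
rewrite /sqnorm dot_comb2 Re_sum; apply: eq_bigr => j _.
by rewrite -csqE.
Qed.

Lemma expansion_orth x k : dot (x - expansion u x) (u k) = 0.
Proof. by rewrite dotBl dot_comb subrr. Qed.

Lemma expansion_pythagoras x : nsq x = \sum_j csq (dot x (u j)) + nsq (x - expansion u x).
Proof.
rewrite -{1}(subrK (expansion u x) x) (sqnormD _ _ (expansion u x)).
rewrite (_ : dot _ (expansion u x) = 0).
  by rewrite (sqnorm_comb (fun j => dot x (u j))) mulr0 addr0 addrC.
by rewrite dot_sumr big1// => j _; rewrite dotZr expansion_orth mulr0.
Qed.

Lemma bessel x : \sum_j csq (dot x (u j)) <= nsq x.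
Proof. by rewrite [leRHS]expansion_pythagoras lerDl sqnorm_ge0. Qed.

End Family.

Lemma gram_schmidt (s : seq H) : exists m (u : 'I_m -> H),
  orthonormal_fam u /\ forall x, x \in s -> x = expansion u x.
Proof.
elim: s => [|x s [m [u [onu us]]]].
  by exists 0, (fun=> 0); split=> [[]|].
have [r0|rn0] := eqVneq (nsq (x - expansion u x)) 0.
  exists m, u; split=> // y; rewrite inE => /orP[/eqP->|/us//].
  by apply/eqP; rewrite -subr_eq0; apply/eqP; exact: sqnorm_eq0 r0.
set r := x - expansion u x in rn0.
have r0 : 0 < nsq r by rewrite lt_def rn0 sqnorm_ge0.
pose c := (Num.sqrt (nsq r))^-1.
have c2 : c ^+ 2 = (nsq r)^-1 by rewrite exprVn sqr_sqrtr ?ltW.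
pose e := c%:C *: r.
have eu k : dot e (u k) = 0 by rewrite dotZl expansion_orth// mulr0.
have ee : dot e e = 1.
  by rewrite dotZl dotZr conjRC sqnormE mulrA -!CM -expr2 c2 mulVf.
pose u' (i : 'I_m.+1) := if unlift ord0 i is Some j then u j else e.
have u'0 : u' ord0 = e by rewrite /u' unlift_none.
have u'S j : u' (lift ord0 j) = u j by rewrite /u' liftK.
have expE y : expansion u' y = dot y e *: e + expansion u y.
  by rewrite /expansion big_ord_recl u'0; under eq_bigr do rewrite u'S.
exists m.+1, u'; split.
  move=> i j; case: (unliftP ord0 i) => [i'|] ->; case: (unliftP ord0 j) => [j'|] ->.
  - by rewrite !u'S onu (inj_eq (@lift_inj _ ord0)).
  - by rewrite u'S u'0 dotC eu rmorph0 -(inj_eq val_inj).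
  - by rewrite u'S u'0 eu -(inj_eq val_inj).
  - by rewrite u'0 ee eqxx.
move=> y; rewrite inE expE => /orP[/eqP->|ys]; last first.
  rewrite (_ : dot y e = 0) ?scale0r ?add0r; first exact: us.
  rewrite (us _ ys) dotC dot_sumr big1 ?rmorph0// => j _.
  by rewrite dotZr eu mulr0.
have xr : x = r + expansion u x by rewrite subrK.
suff -> : dot x e *: e = r by [].
have -> : dot x e = dot r e.
  rewrite xr dotDl (_ : dot (expansion u x) e = 0) ?addr0//.
  by rewrite dot_suml big1// => j _; rewrite dotZl (dotC _ (u j) e) eu rmorph0 mulr0.
rewrite /e dotZr conjRC sqnormE scalerA -!CM mulrAC -expr2 c2 mulVf//.
by rewrite scale1r.
Qed.

(** On the span of [s] with orthonormal basis [f], diagonalize the Hermitian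
matrix of the compression of [A].  The [u_j] are eigenvectors of the
compression only, so [A u_j] may leave the span; but for [x] in the span
[<A x, u_j> = <x, A u_j>] only sees the compression, and [l_j] times
[<x, u_j>] comes out exactly. *)
Lemma eigenbasis A (s : seq H) : linear A -> (forall x y, dot (A x) y = dot x (A y)) ->
  exists m (u : 'I_m -> H) (l : 'I_m -> R),
  [/\ orthonormal_fam u, forall j, dot (A (u j)) (u j) = (l j)%:C &
      forall x, x \in s -> x = expansion u x /\
        forall j, dot (A x) (u j) = (l j)%:C * dot x (u j)].
Proof.
move=> linA symA; have [m [f [onf fs]]] := gram_schmidt s.
pose G : 'M[R[i]]_m := \matrix_(i, j) dot (A (f i)) (f j).
have Gn : G \is normalmx.
  apply: hermitian_normalmx; apply/is_hermitianmxP; rewrite expr0 scale1r.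
  by apply/matrixP => i j; rewrite !mxE symA; exact: dotC.
have /orthomx_spectralP := Gn.
set P := spectralmx G; set sp := spectral_diag G => GE.
have PU : P \is unitarymx by exact: spectral_unitarymx.
have PG : P *m G = diag_mx sp *m P.
  by rewrite GE !mulmxA mulmxV ?mul1mx// spectral_unit.
have PPt k l : \sum_i P k i * Num.conj (P l i) = (k == l)%:R.
  have /unitarymxP/matrixP/(_ k l) := PU; rewrite !mxE => <-.
  by apply: eq_bigr => i _; rewrite !mxE.
have PtP i j : \sum_k Num.conj (P k i) * P k j = (i == j)%:R.
  have /unitarymxP/mulmx1C/matrixP/(_ i j) := PU; rewrite !mxE => <-.
  by apply: eq_bigr => k _; rewrite !mxE.
(* the rows of [P] are left eigenvectors of [G], hence coefficients without
   conjugates *)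
pose u k := \sum_i P k i *: f i.
have Auf k j : dot (A (u k)) (f j) = sp 0 k * P k j.
  have /matrixP/(_ k j) := PG; rewrite mul_diag_mx !mxE => <-.
  rewrite (lin_sum linA) dot_suml; apply: eq_bigr => i _.
  by rewrite (linZ linA) dotZl mxE.
have onu : orthonormal_fam u by move=> k l; rewrite dot_comb2.
have Auu k : dot (A (u k)) (u k) = sp 0 k.
  rewrite [in X in dot _ X]/u dot_sumr.
  under eq_bigr do rewrite dotZr Auf mulrCA (mulrC (Num.conj _)).
  by rewrite -mulr_sumr PPt eqxx mulr1.
have spR k : sp 0 k = (Re (sp 0 k))%:C.
  have : Num.conj (sp 0 k) = sp 0 k by rewrite -Auu -dotC symA.
  case: (sp 0 k) => a b /(congr1 (@complex.Im R))/= h.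
  by congr Complex; lra.
have fE j : f j = \sum_k Num.conj (P k j) *: u k.
  under eq_bigr do rewrite /u scaler_sumr.
  rewrite exchange_big/=.
  under eq_bigr do (under eq_bigr do rewrite scalerA; rewrite -scaler_suml PtP).
  rewrite (bigD1 j)//= eqxx scale1r big1 ?addr0// => i.
  by rewrite eq_sym => /negbTE ->; rewrite scale0r.
exists m, u, (fun k => Re (sp 0 k)); split=> // [k|x /fs xE].
  by rewrite Auu.
have xu k : dot x (u k) = \sum_j dot x (f j) * Num.conj (P k j).
  by rewrite dot_sumr; apply: eq_bigr => j _; rewrite dotZr mulrC.
split=> [|k].
  rewrite {1}xE /expansion; under eq_bigr do rewrite {2}fE scaler_sumr.
  rewrite exchange_big/=; apply: eq_bigr => k _.
  by rewrite xu scaler_suml; apply: eq_bigr => j _; rewrite scalerA.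
rewrite -spR symA {1}xE dot_suml xu mulr_sumr; apply: eq_bigr => j _.
rewrite dotZl (dotC _ (f j) (A _)) Auf conjM spR conjRC; ring.
Qed.

Lemma poly_opE (q : {poly R}) A x :
  poly_op q A x = \sum_(k < size q) (q`_k)%:C *: iter k A x.
Proof. by rewrite /poly_op fct_sumE. Qed.

(** Apply [eigenbasis] to the iterates [A^k x], [k <= N]: by induction on [k] the
coordinates of [A^k x] are [l_j^k <x, u_j>], so polynomials in [A] of degree at
most [N] act on [x] as multiplication by [q(l_j)]. *)
Lemma krylov_diagonalization A (xs : seq H) N : linear A ->
  (forall x y, dot (A x) y = dot x (A y)) ->
  exists m (u : 'I_m -> H) (l : 'I_m -> R),
  [/\ orthonormal_fam u, forall j, dot (A (u j)) (u j) = (l j)%:C &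
      forall x (q : {poly R}), x \in xs -> (size q <= N.+1)%N ->
        poly_op q A x = \sum_j ((q.[l j])%:C * dot x (u j)) *: u j].
Proof.
move=> linA symA.
have [m [u [l [onu lE us]]]] :=
  eigenbasis [seq iter k A x | x <- xs, k <- iota 0 N.+1] linA symA.
exists m, u, l; split=> // x q xs_x sq.
have mem k : (k <= N)%N -> iter k A x \in [seq iter k A x | x <- xs, k <- iota 0 N.+1].
  by move=> kN; apply/allpairsP; exists (x, k); rewrite mem_iota.
have dotk k : (k <= N)%N -> forall j, dot (iter k A x) (u j) = (l j ^+ k)%:C * dot x (u j).
  elim: k => [|k IH] kN j; first by rewrite expr0 mul1r.
  rewrite iterS (us _ (mem _ (ltnW kN))).2 IH 1?ltnW// exprS CM; ring.
rewrite poly_opE.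
transitivity (\sum_(k < size q) \sum_j ((q`_k * l j ^+ k)%:C * dot x (u j)) *: u j).
  apply: eq_bigr => k _; have kN : (k <= N)%N.
    by rewrite -ltnS (leq_trans _ sq).
  rewrite {1}(us _ (mem _ kN)).1 scaler_sumr; apply: eq_bigr => j _.
  by rewrite dotk// scalerA CM mulrA.
rewrite exchange_big; apply: eq_bigr => j _.
by rewrite -scaler_suml -mulr_suml horner_coef sumC.
Qed.

Lemma positive_eigen_bound A x (l : R) : positive_op dot A -> nsq x = 1 ->
  dot (A x) x = l%:C -> 0 <= l <= opnorm A.
Proof.
move=> [bA pA] x1 lE; have := pA x; rewrite lE ler0c => l0; rewrite l0/=.
have := dot_csq dot (A x) x; rewrite lE csqR x1 mulr1 => h.
have := opnorm_bound x bA; rewrite x1 mulr1 => /(le_trans h).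
by rewrite ler_pXn2r// nnegrE ?opnorm_ge0.
Qed.

End Hilbert3.

(** * Functional calculus *)

Lemma uniformP (R : realType) (D : set R) (q : nat -> R -> R) (f : R -> R) :
  ({uniform D, q @ \oo --> f} <->
  forall e : R, 0 < e -> exists N, forall n, (N <= n)%N ->
    forall t, D t -> `|q n t - f t| < e)%classic.
Proof.
split.
  move=> h e e0.
  have : nbhs (f : {uniform` D -> R}) [set g : R -> R | forall t, D t -> `|g t - f t| < e]%classic.
    apply/uniform_nbhs; exists [set xy | `|xy.1 - xy.2| < e]%classic; split.
      by rewrite -entourage_ballE; exists e.
    by move=> g /= hg t Dt; rewrite distrC; exact: hg.
  by move=> /h[N _ hN]; exists N => n Nn; apply: hN.
move=> h P /uniform_nbhs[E [+ EP]]; rewrite -entourage_ballE => -[e /= e0 eE].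
have [N hN] := h e e0; exists N => // n /= Nn; apply: EP => t Dt.
by apply: eE; rewrite /= /ball/= distrC; apply: hN.
Qed.

Section FunctionalCalculus.
Context {R : realType} {H : completeNormedModType R[i]}.
Variable dot : {dot H for (@Num.conj R[i])}.
Hypothesis dot_norm : induces_norm dot.
Local Notation Re := complex.Re.
Local Notation nsq := (sqnorm dot).
Implicit Types (x y z v : H) (a b : R[i]) (A B : H -> H).

(** The norm of [H] as a real number; the norm of a normed module over the complex
numbers takes complex values. *)
Definition hnorm x : R := Num.sqrt (nsq x).
Local Notation hn := hnorm.

Lemma hnorm_ge0 x : 0 <= hn x. Proof. exact: sqrtr_ge0. Qed.
Lemma hnorm2 x : hn x ^+ 2 = nsq x. Proof. by rewrite sqr_sqrtr ?sqnorm_ge0. Qed.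
Lemma hnormBC x y : hn (x - y) = hn (y - x). Proof. by rewrite /hnorm sqnormBC. Qed.
Lemma hnormZ a x : hn (a *: x) = Num.sqrt (csq a) * hn x.
Proof. by rewrite /hnorm sqnormZ sqrtrM ?csq_ge0. Qed.
Lemma hnormD x y : hn (x + y) <= hn x + hn y.
Proof. by rewrite -lecR rmorphD/= -!(normE dot_norm) ler_normD. Qed.
Lemma hnorm_eq0 x : hn x = 0 -> x = 0.
Proof. by move=> h; apply: (@sqnorm_eq0 _ _ dot); rewrite -hnorm2 h expr0n. Qed.
Lemma hnorm_le x (e : R) : 0 <= e -> (hn x <= e) = (nsq x <= e ^+ 2).
Proof. by move=> e0; rewrite -hnorm2 ler_pXn2r// nnegrE hnorm_ge0. Qed.
Lemma hnormN x : hn (- x) = hn x. Proof. by rewrite /hnorm sqnormN. Qed.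
Lemma hnormB x y : hn (x - y) <= hn x + hn y.
Proof. by rewrite -(hnormN y) hnormD. Qed.

Lemma csq_dot_le x y : csq (dot x y) <= (hn x * hn y) ^+ 2.
Proof. by rewrite exprMn !hnorm2 dot_csq. Qed.

Lemma Re_dot_le x y : `|Re (dot x y)| <= hn x * hn y.
Proof.
rewrite -[leRHS]ger0_norm ?mulr_ge0 ?hnorm_ge0// -ler_sqr ?nnegrE// !real_normK ?num_real//.
by apply: le_trans (csq_dot_le _ _); rewrite csqRI lerDl sqr_ge0.
Qed.

Lemma Im_dot_le x y : `|complex.Im (dot x y)| <= hn x * hn y.
Proof.
rewrite -[leRHS]ger0_norm ?mulr_ge0 ?hnorm_ge0// -ler_sqr ?nnegrE// !real_normK ?num_real//.
by apply: le_trans (csq_dot_le _ _); rewrite csqRI lerDr sqr_ge0.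
Qed.

Lemma le_of_all_eps (c d : R) (k : R) : 0 <= k -> (forall e, 0 < e -> c <= d + k * e) -> c <= d.
Proof.
move=> k0 h; apply/ler_addgt0Pr => e e0.
have k1 : 0 < k + 1 by lra.
apply: le_trans (h (e / (k + 1)) (divr_gt0 e0 k1)) _.
by rewrite lerD2l mulrCA ler_piMr ?(ltW e0)// ler_pdivrMr// mul1r lerDl.
Qed.

Lemma poly_op_widen (q : {poly R}) A x n : (size q <= n)%N ->
  poly_op q A x = \sum_(k < n) (q`_k)%:C *: iter k A x.
Proof.
move=> qn; rewrite poly_opE.
rewrite (big_ord_widen n (fun k => (q`_k)%:C *: iter k A x) qn).
rewrite big_mkcond; apply: eq_bigr => k _; case: ifPn => // /negbTE.
by move=> /negbT; rewrite -leqNgt => /(nth_default 0)->; rewrite scale0r.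
Qed.

Lemma poly_opB (q r : {poly R}) A x :
  poly_op (q - r) A x = poly_op q A x - poly_op r A x.
Proof.
set n := maxn (size q) (size r).
rewrite !(@poly_op_widen _ _ _ n) ?leq_maxl ?leq_maxr//; last first.
  by rewrite (leq_trans (size_polyD _ _))// size_polyN.
rewrite -sumrB; apply: eq_bigr => k _.
by rewrite coefB rmorphB/= scalerBl.
Qed.

Lemma poly_op_linear (q : {poly R}) A : linear A -> linear (poly_op q A).
Proof.
move=> linA a x y; rewrite !poly_opE scaler_sumr -big_split/=.
apply: eq_bigr => k _; rewrite scalerA mulrC -scalerA -scalerDr; congr (_ *: _).
by elim: (nat_of_ord k) => //= n ->; rewrite linA.
Qed.

Lemma poly_op1 A x : poly_op 1 A x = x.
Proof. by rewrite poly_opE size_poly1 big_ord1 coef1 eqxx scale1r. Qed.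

Lemma poly_opX A x : poly_op 'X A x = A x.
Proof.
by rewrite poly_opE size_polyX !big_ord_recl big_ord0 !coefX/= scale0r scale1r add0r addr0.
Qed.

Section Positive.
Variable A : H -> H.
Hypothesis posA : positive_op dot A.
Let bA : bounded_op A := posA.1.
Let linA : linear A := posA.1.1.
Local Notation M := (opnorm A).

(** For a positive operator the nodes [l_j] lie between [0] and [opnorm A]: this is a
Gauss quadrature for the spectral measures of the vectors [xs], exact for
polynomials of degree at most [N]. *)
Lemma spectral_quadrature (xs : seq H) N : exists m (u : 'I_m -> H) (l : 'I_m -> R),
  [/\ orthonormal_fam dot u, forall j, 0 <= l j <= M,
      forall j, dot (A (u j)) (u j) = (l j)%:C &
      forall x, x \in xs ->
       (forall y, dot x y = \sum_j dot x (u j) * dot (u j) y) /\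
       forall q : {poly R}, (size q <= N.+1)%N ->
        poly_op q A x = \sum_j ((q.[l j])%:C * dot x (u j)) *: u j].
Proof.
have [m [u [l [onu lE us]]]] := krylov_diagonalization xs N linA (positive_selfadjoint posA).
exists m, u, l; split=> // [j|x xs_x].
  apply: (positive_eigen_bound dot_norm posA _ (lE j)).
  by rewrite /sqnorm onu eqxx.
split=> [y|q]; last exact: us.
have := us x 1 xs_x; rewrite size_poly1 => /(_ isT); rewrite poly_op1 => {1}->.
rewrite dot_suml; apply: eq_bigr => j _.
by rewrite dotZl hornerE mul1r.
Qed.

Lemma poly_op_bound (q : {poly R}) (e : R) x : 0 <= e ->
  (forall t, 0 <= t <= M -> `|q.[t]| <= e) -> hn (poly_op q A x) <= e * hn x.
Proof.
move=> e0 qe; have [m [u [l [onu lM _ us]]]] := spectral_quadrature [:: x] (size q).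
rewrite hnorm_le ?mulr_ge0 ?hnorm_ge0// exprMn hnorm2.
rewrite (us x _).2 ?inE// sqnorm_comb//.
apply: le_trans (_ : e ^+ 2 * \sum_j csq (dot x (u j)) <= _); last first.
  by rewrite ler_wpM2l ?sqr_ge0// bessel.
rewrite mulr_sumr; apply: ler_sum => j _; rewrite csqM csqR.
rewrite ler_wpM2r ?csq_ge0// -(real_normK (num_real _)).
by rewrite ler_pXn2r ?nnegrE// qe.
Qed.

Lemma poly_form (q : {poly R}) x : complex.Im (dot (poly_op q A x) x) = 0 /\
  forall c : R, (forall t, 0 <= t <= M -> c <= q.[t]) ->
    c * nsq x <= Re (dot (poly_op q A x) x).
Proof.
have [m [u [l [onu lM _ us]]]] := spectral_quadrature [:: x] (size q).
have [xE qE] := us x (mem_head _ _).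
have -> : dot (poly_op q A x) x = (\sum_j q.[l j] * csq (dot x (u j)))%:C.
  rewrite qE// dot_suml sumC; apply: eq_bigr => j _.
  by rewrite dotZl -mulrA CM csqE (dotC _ (u j)).
split=> // c qc /=.
have -> : nsq x = \sum_j csq (dot x (u j)).
  by rewrite /sqnorm xE Re_sum; apply: eq_bigr => j _; rewrite (dotC _ (u j)).
rewrite mulr_sumr; apply: ler_sum => j _.
by rewrite ler_wpM2r ?csq_ge0// qc.
Qed.

Definition approximable (f : R -> R) := forall e : R, 0 < e ->
  exists q : {poly R}, forall t, 0 <= t <= M -> `|q.[t] - f t| <= e.

Lemma approximating_sequence f : approximable f -> exists q : nat -> {poly R},
  forall n t, 0 <= t <= M -> `|(q n).[t] - f t| <= n.+1%:R^-1.
Proof.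
move=> af; have ex (n : nat) : exists q : {poly R}, forall t, 0 <= t <= M ->
    `|q.[t] - f t| <= n.+1%:R^-1.
  by apply: af; rewrite invr_gt0 ltr0n.
by have /choice[q qP] := ex; exists q.
Qed.

(** The quantitative content of the functional calculus [is_fun_calc]: polynomials
close to [f] between [0] and [opnorm A] give operators close to [B], with the same
error. *)
Definition fcalc (f : R -> R) B := linear B /\
  forall (q : {poly R}) (e : R), 0 <= e ->
    (forall t, 0 <= t <= M -> `|q.[t] - f t| <= e) ->
    forall x, hn (poly_op q A x - B x) <= e * hn x.

(** [B x] is the limit of [q_n(A) x] for polynomials [q_n] converging uniformly to
[f]; the sequence is Cauchy because the norm of [q(A)] is at most the supremum
of [|q|] between [0] and [opnorm A]. *)
Lemma fcalc_exists f : approximable f -> exists B, fcalc f B.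
Proof.
move=> af.
have [q qP] := approximating_sequence af.
have dist (r : {poly R}) (e : R) n x : 0 <= e ->
    (forall t, 0 <= t <= M -> `|r.[t] - f t| <= e) ->
    hn (poly_op r A x - poly_op (q n) A x) <= (e + n.+1%:R^-1) * hn x.
  move=> e0 re; rewrite -poly_opB; apply: poly_op_bound.
    by rewrite addr_ge0// invr_ge0.
  move=> t tM; rewrite hornerD hornerN.
  rewrite (_ : _ - _ = (r.[t] - f t) - ((q n).[t] - f t)); last by ring.
  by apply: le_trans (ler_normB _ _) _; rewrite lerD ?re ?qP.
have lim x : exists y, hlim dot (fun n => poly_op (q n) A x) y.
  apply: (hcomplete dot_norm) => e e0.
  have x1 : 0 < 2 * (hn x + 1) by have := hnorm_ge0 x; lra.
  have s0 : 0 < Num.sqrt e by rewrite sqrtr_gt0.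
  have [N hN] := invS_lt_eventually (divr_gt0 s0 x1).
  exists N => n k /hN hn_ /hN hk.
  rewrite -hnorm2 -(sqr_sqrtr (ltW e0)) ltr_pXn2r ?nnegrE ?hnorm_ge0 ?sqrtr_ge0//.
  have ni : 0 <= n.+1%:R^-1 :> R by rewrite invr_ge0.
  apply: le_lt_trans (dist (q n) _ k x ni (qP n)) _.
  have ki : 0 <= k.+1%:R^-1 :> R by rewrite invr_ge0.
  move: hn_ hk; rewrite !ltr_pdivlMr//; have := hnorm_ge0 x.
  move: (n.+1%:R^-1) (k.+1%:R^-1) (hn x) ni ki => n' k' h ni ki; nra.
have /choice[B BP] := lim.
have main (r : {poly R}) (e : R) : 0 <= e ->
    (forall t, 0 <= t <= M -> `|r.[t] - f t| <= e) ->
    forall x, hn (poly_op r A x - B x) <= e * hn x.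
  move=> e0 re x; apply: (@le_of_all_eps _ _ (hn x + 1)).
    by rewrite addr_ge0 ?hnorm_ge0.
  move=> d d0; have [N1 hN1] := invS_lt_eventually d0.
  have [N2 hN2] := BP x (d ^+ 2) (exprn_gt0 _ d0).
  pose n := maxn N1 N2.
  have h1 := dist r e n x e0 re.
  have h2 : hn (poly_op (q n) A x - B x) <= d.
    by rewrite hnormBC hnorm_le ?(ltW d0)// ltW// hN2// leq_maxr.
  have h3 := hN1 n (leq_maxl _ _).
  rewrite -(subrK (poly_op (q n) A x) (poly_op r A x)) -addrA.
  apply: le_trans (hnormD _ _) _; apply: le_trans (lerD h1 h2) _.
  have h4 : n.+1%:R^-1 * hn x <= d * hn x.
    by apply: ler_wpM2r; [exact: hnorm_ge0 | exact: ltW].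
  by rewrite mulrDl mulrDl mul1r -addrA lerD2l (mulrC (hn x)) lerD2r.
exists B; split=> // a x y; apply/eqP; rewrite -subr_eq0; apply/eqP/hnorm_eq0/eqP.
rewrite eq_le hnorm_ge0 andbT.
apply: (@le_of_all_eps _ _ (hn (a *: x + y) + Num.sqrt (csq a) * hn x + hn y)).
  by rewrite !addr_ge0 ?mulr_ge0 ?sqrtr_ge0 ?hnorm_ge0.
move=> e e0; have [r re] := af e e0; have hr := main r e (ltW e0) re.
rewrite add0r.
have -> : B (a *: x + y) - (a *: B x + B y) =
   (a *: (poly_op r A x - B x) + (poly_op r A y - B y)) -
   (poly_op r A (a *: x + y) - B (a *: x + y)).
  rewrite (poly_op_linear r linA) scalerBr.
  move: (a *: poly_op r A x) (poly_op r A y) (a *: B x) (B y) => X Y P Q.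
  by rewrite (addrACA X) -(opprD P) [RHS]addrC opprB addrA subrK.
apply: le_trans (hnormB _ _) _; apply: le_trans (lerD (hnormD _ _) (hr _)) _.
rewrite hnormZ; have := ler_wpM2l (sqrtr_ge0 (csq a)) (hr x); have := hr y; lra.
Qed.

End Positive.
End FunctionalCalculus.

(** * Powers and square roots of positive operators *)

Section FunctionalCalculus2.
Context {R : realType} {H : completeNormedModType R[i]}.
Variable dot : {dot H for (@Num.conj R[i])}.
Hypothesis dot_norm : induces_norm dot.
Local Notation Re := complex.Re.
Local Notation nsq := (sqnorm dot).
Local Notation hn := (hnorm dot).
Implicit Types (x y z v : H) (a b : R[i]) (A B : H -> H).

Lemma bounded_op_hn A : bounded_op A -> exists2 c : R, 0 <= c & forall x, hn (A x) <= c * hn x.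
Proof.
move=> bA; exists (opnorm A) => [|x]; first exact: (opnorm_ge0 dot_norm).
have M0 := opnorm_ge0 dot_norm bA.
by rewrite hnorm_le ?mulr_ge0 ?hnorm_ge0// exprMn hnorm2 (opnorm_bound dot_norm).
Qed.

Lemma bounded_op_hnI A (c : R) : linear A -> 0 <= c -> (forall x, hn (A x) <= c * hn x) ->
  bounded_op A.
Proof.
move=> linA c0 Ac; apply: (bounded_opI dot_norm linA (sqr_ge0 c)) => x.
by rewrite -!hnorm2 -exprMn ler_pXn2r ?nnegrE ?mulr_ge0 ?hnorm_ge0.
Qed.

Lemma bounded_op_comb a b A B : bounded_op A -> bounded_op B ->
  bounded_op (a *: A + b *: B).
Proof.
move=> bA bB; have [c c0 Ac] := bounded_op_hn bA; have [d d0 Bd] := bounded_op_hn bB.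
apply: (@bounded_op_hnI _ (Num.sqrt (csq a) * c + Num.sqrt (csq b) * d)).
- move=> k x y; rewrite !fctE bA.1 bB.1 !scalerDr !scalerA.
  by rewrite (mulrC a) (mulrC b) -!addrA; congr (_ + _); rewrite addrCA.
- by rewrite addr_ge0// mulr_ge0// sqrtr_ge0.
move=> x; rewrite !fctE; apply: le_trans (hnormD dot_norm _ _) _.
by rewrite !hnormZ mulrDl -!mulrA lerD// ler_wpM2l ?sqrtr_ge0.
Qed.

Lemma bounded_op_comp A B : bounded_op A -> bounded_op B -> bounded_op (A \o B).
Proof.
move=> bA bB; have [c c0 Ac] := bounded_op_hn bA; have [d d0 Bd] := bounded_op_hn bB.
apply: (@bounded_op_hnI _ (c * d)); last 2 first.
- exact: mulr_ge0.
- by move=> x; apply: le_trans (Ac _) _; rewrite -mulrA ler_wpM2l.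
by move=> k x y /=; rewrite bB.1 bA.1.
Qed.

(** Expanding the form at [x + D x] leaves twice the squared norm of [D x]. *)
Lemma selfadjoint_form_eq0 D : linear D -> (forall x y, dot (D x) y = dot x (D y)) ->
  (forall x, Re (dot (D x) x) = 0) -> forall x, D x = 0.
Proof.
move=> linD_ symD D0 x; apply: (@sqnorm_eq0 _ _ dot).
have := D0 (x + D x); rewrite (linD linD_) dotDl !dotDr !ReD !D0.
rewrite (symD (D x)) sqnormE /=; lra.
Qed.

Section Positive.
Variable A : H -> H.
Hypothesis posA : positive_op dot A.
Let bA : bounded_op A := posA.1.
Let linA : linear A := posA.1.1.
Local Notation M := (opnorm A).
Let M0 : 0 <= M := opnorm_ge0 dot_norm bA.

Lemma poly_bounded (q : {poly R}) : exists2 K : R, 0 <= K &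
  forall t, 0 <= t <= M -> `|q.[t]| <= K.
Proof.
exists (\sum_(k < size q) `|q`_k| * M ^+ k).
  by apply: sumr_ge0 => k _; rewrite mulr_ge0// exprn_ge0.
move=> t /andP[t0 tM]; rewrite horner_coef; apply: le_trans (ler_norm_sum _ _ _) _.
apply: ler_sum => k _; rewrite normrM ler_wpM2l// ger0_norm ?exprn_ge0//.
by rewrite lerXn2r// nnegrE.
Qed.

Lemma bounded_poly_op (q : {poly R}) : bounded_op (poly_op q A).
Proof.
have [K K0 qK] := poly_bounded q.
apply: (bounded_op_hnI (poly_op_linear q linA) K0) => x.
exact: poly_op_bound.
Qed.

Lemma poly_approximable f : (forall M, quasi_lipschitz f M) -> approximable A f.
Proof.
move=> qf e e0.
have M1 : 0 < M + 1 by rewrite ltr_wpDl.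
have [q qP] := poly_approx M1 (qf _) e0; exists q => t /andP[t0 tM].
by apply: qP; rewrite t0/= (le_trans tM)// lerDl.
Qed.

Lemma approximable_powR p : 1 <= p -> approximable A (fun t => t `^ p).
Proof. by move=> p1; apply: poly_approximable => ?; exact: powR_quasi_lipschitz. Qed.

Section Value.
Variables (f : R -> R) (B : H -> H).
Hypotheses (af : approximable A f) (fB : fcalc dot A f B).

Lemma fcalc_bounded : bounded_op B.
Proof.
have [q qf] := af ltr01; have [K K0 qK] := bounded_op_hn (bounded_poly_op q).
apply: (@bounded_op_hnI _ (K + 1)); [exact: fB.1|by rewrite addr_ge0|].
move=> x; rewrite -(subKr (poly_op q A x) (B x)) mulrDl.
apply: le_trans (hnormB dot_norm _ _) _.
by apply: lerD; [exact: qK|exact: (fB.2 _ _ ler01 qf)].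
Qed.

Lemma fcalc_is_fun_calc : is_fun_calc f A B.
Proof.
split; first exact: fcalc_bounded.
move=> q /uniformP qf; apply/cvgrPdist_le => e e0.
have [N qN] := qf e e0; exists N => // n /= Nn.
rewrite sub0r normrN.
have bd : bounded_op (poly_op (q n) A - B).
  have := bounded_op_comb 1 (-1) (bounded_poly_op (q n)) fcalc_bounded.
  by rewrite scaleN1r scale1r.
rewrite ger0_norm ?(opnorm_ge0 dot_norm)//.
apply: (opnorm_le dot_norm) => [|x]; first exact: ltW.
rewrite -!hnorm2 -exprMn ler_pXn2r ?nnegrE ?mulr_ge0 ?hnorm_ge0 ?(ltW e0)//.
rewrite !fctE; apply: fB.2; first exact: ltW.
by move=> t tM; apply/ltW/qN => //=; rewrite in_itv.
Qed.

(** Both [B] and [B'] are limits of the same polynomials in [A]. *)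
Lemma is_fun_calc_unique B' : is_fun_calc f A B' -> B' = B.
Proof.
move=> [bB' hB']; apply/funext => x; apply/eqP; rewrite -subr_eq0; apply/eqP.
apply: (@hnorm_eq0 _ _ dot); apply/eqP; rewrite eq_le hnorm_ge0 andbT.
have [q qP] := approximating_sequence af.
have /hB' : {uniform `[0, M], (fun n t => (q n).[t]) @ \oo --> f}%classic.
  apply/uniformP => e /invS_lt_eventually[N hN]; exists N => n /hN; rewrite /= => h t.
  by rewrite in_itv => /qP /le_lt_trans; exact.
move=> /cvgrPdist_le h; apply: (@le_of_all_eps _ _ _ (2 * hn x)).
  by rewrite mulr_ge0 ?hnorm_ge0.
move=> e e0; have [N1 _ hN1] := h e e0; have [N2 hN2] := invS_lt_eventually e0.
pose n := maxn N1 N2.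
have h1 : hn (poly_op (q n) A x - B' x) <= e * hn x.
  have bd : bounded_op (poly_op (q n) A - B').
    have := bounded_op_comb 1 (-1) (bounded_poly_op (q n)) bB'.
    by rewrite scaleN1r scale1r.
  have := hN1 n (leq_maxl _ _); rewrite sub0r normrN ger0_norm ?(opnorm_ge0 dot_norm)// => h1.
  rewrite hnorm_le ?mulr_ge0 ?hnorm_ge0 ?(ltW e0)// exprMn hnorm2.
  apply: le_trans (opnorm_bound dot_norm x bd) _.
  by rewrite ler_wpM2r ?sqnorm_ge0// lerXn2r ?nnegrE ?(opnorm_ge0 dot_norm)// ltW.
have h2 : hn (poly_op (q n) A x - B x) <= e * hn x.
  apply: fB.2; first exact: ltW.
  by move=> t /qP /le_trans; apply; apply/ltW/hN2; exact: leq_maxr.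
rewrite -(subrK (poly_op (q n) A x) (B' x)) -addrA.
apply: le_trans (hnormD dot_norm _ _) _; rewrite hnormBC; lra.
Qed.

Lemma fcalc_real x : complex.Im (dot (B x) x) = 0.
Proof.
apply/normr0_eq0/eqP; rewrite eq_le normr_ge0 andbT.
apply: (@le_of_all_eps _ _ _ (hn x ^+ 2)); first exact: sqr_ge0.
move=> e e0; have [q qf] := af e0; rewrite add0r.
have := Im_dot_le dot (poly_op q A x - B x) x.
rewrite dotBl raddfB/= (poly_form dot_norm posA q x).1 sub0r normrN => /le_trans; apply.
by rewrite mulrC expr2 -mulrA ler_wpM2l ?hnorm_ge0// mulrC (fB.2 _ _ (ltW e0) qf).
Qed.

(** Monotonicity of the functional calculus, with a polynomial on the lower side:
approximate [f] by [q], so that [q - r] is almost nonnegative on the spectrum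
and its form is almost nonnegative by quadrature. *)
Lemma fcalc_ge (r : {poly R}) x : (forall t, 0 <= t <= M -> r.[t] <= f t) ->
  Re (dot (poly_op r A x) x) <= Re (dot (B x) x).
Proof.
move=> rf; apply: (@le_of_all_eps _ _ _ (2 * hn x ^+ 2)); first by rewrite mulr_ge0 ?sqr_ge0.
move=> e e0; have [q qf] := af e0.
have h1 : - e * nsq x <= Re (dot (poly_op (q - r) A x) x).
  apply: (poly_form dot_norm posA _ x).2 => t tM.
  have := rf t tM; have := qf t tM; rewrite hornerD hornerN ler_norml; lra.
have h2 : `|Re (dot (poly_op q A x - B x) x)| <= e * hn x * hn x.
  apply: le_trans (Re_dot_le _ _ _) _; rewrite ler_wpM2r ?hnorm_ge0//.
  exact: (fB.2 _ _ (ltW e0) qf).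
move: h1 h2; rewrite poly_opB !dotBl !ReB -hnorm2 ler_norml => h1 /andP[_ h2].
nra.
Qed.

Lemma fcalc_positive : (forall t, 0 <= t <= M -> 0 <= f t) -> positive_op dot B.
Proof.
move=> f0; split; first exact: fcalc_bounded.
move=> x; have := @fcalc_ge 0 x; rewrite (_ : poly_op 0 A x = 0); last first.
  by rewrite poly_opE size_poly0 big_ord0.
rewrite dot0l => /(_ _)/=.
have := fcalc_real x; case: (dot (B x) x) => a b /= ->.
by rewrite lecE/= eqxx; apply=> t tM; rewrite horner0 f0.
Qed.

End Value.

Lemma fun_calcP f : approximable A f -> fcalc dot A f (fun_calc f A).
Proof.
move=> af; have [B fB] := fcalc_exists dot_norm posA af.
have ex : exists B, is_fun_calc f A B by exists B; exact: fcalc_is_fun_calc.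
have := xgetPex (0 : H -> H) ex; rewrite -/(fun_calc f A) => h.
by rewrite (is_fun_calc_unique af fB h).
Qed.

(** Squares are compared at the nodes of the quadrature: if [q] is close to the
square root, then [|q(A) x|^2 = sum_j q(l_j)^2 |<x, u_j>|^2] is close to
[sum_j l_j |<x, u_j>|^2 = <A x, x>]. *)
Lemma fcalc_sqrt_nsq B x : fcalc dot A Num.sqrt B -> nsq (B x) = Re (dot (A x) x).
Proof.
move=> fB; have af : approximable A Num.sqrt.
  by apply: poly_approximable => ?; exact: sqrt_quasi_lipschitz.
pose K := hn x * (2 * hn (B x) + hn x) + (2 * Num.sqrt M + 1) * hn x ^+ 2.
have K0 : 0 <= K.
  have s0 : 0 <= 2 * Num.sqrt M + 1 by have := sqrtr_ge0 M; lra.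
  by rewrite /K addr_ge0 ?mulr_ge0 ?addr_ge0 ?mulr_ge0 ?hnorm_ge0 ?sqr_ge0 ?sqrtr_ge0.
suff main (e : R) : 0 < e -> `|nsq (B x) - Re (dot (A x) x)| <= 0 + K * e.
  apply/eqP; rewrite -subr_eq0 -normr_le0.
  exact: (le_of_all_eps K0 main).
(* [q] is bounded by [sqrt M + 1] only for errors at most one *)
move=> e0'; pose e1 := Num.min e 1.
have e0 : 0 < e1 by rewrite lt_min e0' ltr01.
have e11 : e1 <= 1 by rewrite ge_min lexx orbT.
have ee1 : e1 <= e by rewrite ge_min lexx.
rewrite add0r; apply: le_trans (ler_wpM2l K0 ee1).
move: e1 e0 e11 {ee1 e0'} => {}e e0 e1.
have [q qf] := af e e0.
have hB := fB.2 q e (ltW e0) qf x.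
have [m [u [l [onu lM lE us]]]] := spectral_quadrature dot_norm posA [:: x] (maxn (size q) 2).
have [xE qE] := us x (mem_head _ _).
have nq : nsq (poly_op q A x) = \sum_j q.[l j] ^+ 2 * csq (dot x (u j)).
  rewrite qE ?leqW ?leq_maxl// sqnorm_comb//.
  by apply: eq_bigr => j _; rewrite csqM csqR.
have nA : Re (dot (A x) x) = \sum_j l j * csq (dot x (u j)).
  rewrite -[A x]poly_opX qE ?size_polyX ?leqW ?leq_maxr//.
  rewrite dot_suml Re_sum; apply: eq_bigr => j _.
  by rewrite dotZl hornerX -mulrA ReZ (dotC _ (u j)).
have h1 : `|nsq (poly_op q A x) - Re (dot (A x) x)| <= (2 * Num.sqrt M + 1) * hn x ^+ 2 * e.
  rewrite nq nA -sumrB; apply: le_trans (ler_norm_sum _ _ _) _.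
  rewrite mulrAC hnorm2; apply: le_trans (_ : (2 * Num.sqrt M + 1) * e *
     \sum_j csq (dot x (u j)) <= _); last first.
    by rewrite ler_wpM2l ?bessel// mulr_ge0 ?(ltW e0).
  rewrite mulr_sumr; apply: ler_sum => j _.
  rewrite -mulrBl normrM (ger0_norm (csq_ge0 _)) ler_wpM2r ?csq_ge0//.
  have /andP[l0 lM_] := lM j; have := qf _ (lM j).
  have -> : q.[l j] ^+ 2 - l j = q.[l j] ^+ 2 - Num.sqrt (l j) ^+ 2.
    by rewrite sqr_sqrtr.
  rewrite subr_sqr normrM => h; rewrite mulrC ler_pM//.
  have : Num.sqrt (l j) <= Num.sqrt M by rewrite ler_sqrt.
  have := sqrtr_ge0 (l j); move: h; rewrite !ler_norml => /andP[? ?] ? ?.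
  by apply/andP; split; lra.
have h2 : `|nsq (B x) - nsq (poly_op q A x)| <= hn x * (2 * hn (B x) + hn x) * e.
  rewrite -!hnorm2 subr_sqr normrM.
  have t1 : `|hn (B x) - hn (poly_op q A x)| <= e * hn x.
    rewrite ler_norml; apply/andP; split.
      have := hnormD dot_norm (B x) (poly_op q A x - B x); rewrite addrC subrK; lra.
    have := hnormB dot_norm (poly_op q A x) (poly_op q A x - B x); rewrite subKr; lra.
  have t2 : `|hn (B x) + hn (poly_op q A x)| <= 2 * hn (B x) + hn x.
    rewrite ger0_norm ?addr_ge0 ?hnorm_ge0//; move: t1; rewrite ler_norml => /andP[+ _].
    have : e * hn x <= hn x by rewrite ler_piMl ?hnorm_ge0.
    lra.
  apply: le_trans (ler_pM (normr_ge0 _) (normr_ge0 _) t1 t2) _.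
  by rewrite mulrAC (mulrC e) mulrAC -mulrA mulrCA mulrA mulrC mulrA.
rewrite /K mulrDl -(subrK (nsq (poly_op q A x)) (nsq (B x))) -addrA.
by apply: le_trans (ler_normD _ _) _; exact: lerD.
Qed.

(** [B B - A] is self-adjoint with zero quadratic form for [B] the square root
given by the functional calculus. *)
Lemma op_sqrtP : positive_op dot (op_sqrt dot A) /\ op_sqrt dot A \o op_sqrt dot A = A.
Proof.
have af : approximable A Num.sqrt.
  by apply: poly_approximable => ?; exact: sqrt_quasi_lipschitz.
have [B fB] := fcalc_exists dot_norm posA af.
have pB : positive_op dot B.
  by apply: (fcalc_positive af fB) => t _; exact: sqrtr_ge0.
have BB : B \o B = A.
  have sB := positive_selfadjoint pB; have sA := positive_selfadjoint posA.
  pose D x := B (B x) - A x.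
  have D0 : forall x, D x = 0.
    apply: selfadjoint_form_eq0.
    - by move=> a x y; rewrite /D !pB.1.1 linA scalerBr opprD addrACA.
    - by move=> x y; rewrite /D dotBl dotBr sB sB sA.
    - by move=> x; rewrite /D dotBl ReB sB -(fcalc_sqrt_nsq _ fB) subrr.
  by apply/funext => x /=; apply/eqP; rewrite -subr_eq0; apply/eqP/D0.
have ex : exists B, positive_op dot B /\ B \o B = A by exists B.
exact: (xgetPex (0 : H -> H) ex).
Qed.

End Positive.
End FunctionalCalculus2.

(** * Trace inequalities *)

Section Trace.
Context {R : realType} {H : completeNormedModType R[i]}.
Variable dot : {dot H for (@Num.conj R[i])}.
Hypothesis dot_norm : induces_norm dot.
Local Notation Re := complex.Re.
Local Notation nsq := (sqnorm dot).
Local Notation hn := (hnorm dot).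
Implicit Types (x y z v : H) (a b : R[i]) (A C : H -> H).

(** Bessel's inequality for the images of an orthonormal family under a
contraction [C].  With [s] the left-hand side and [z] the combination of the
[u_k] with coefficients the conjugates of [<C u_k, h>], one has [<C z, h> = s]
and [|z|^2 = s], hence [s^2 <= s |h|^2]. *)
Lemma contraction_bessel m (u : 'I_m -> H) C h : orthonormal_fam dot u -> linear C ->
  (forall x, nsq (C x) <= nsq x) -> \sum_k csq (dot (C (u k)) h) <= nsq h.
Proof.
move=> onu linC C1; pose c k := dot (C (u k)) h; rewrite -/(c _).
set s := \sum_k _; pose z := \sum_k Num.conj (c k) *: u k.
have s0 : 0 <= s by apply: sumr_ge0 => k _; exact: csq_ge0.
have nz : nsq z = s.
  by rewrite sqnorm_comb//; apply: eq_bigr => k _; exact: csq_conj.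
have Cz : dot (C z) h = s%:C.
  rewrite (lin_sum linC) dot_suml sumC; apply: eq_bigr => k _.
  by rewrite (linZ linC) dotZl csqE mulrC.
have : s ^+ 2 <= s * nsq h.
  rewrite -csqR -Cz; apply: le_trans (dot_csq _ _ _) _.
  by rewrite ler_wpM2r ?sqnorm_ge0// -nz.
have [->|sn0] := eqVneq s 0; first by rewrite sqnorm_ge0.
by rewrite expr2 ler_pM2l// lt_def sn0.
Qed.

Section Basis.
Variable B : set H.
Hypothesis basisB : is_orthonormal_basis dot B.

Lemma basis_fam (s : seq H) : uniq s -> (forall e, e \in s -> B e) ->
  orthonormal_fam dot (fun i : 'I_(size s) => nth 0 s i).
Proof.
move=> us sB i j; rewrite basisB.1; [|by apply: sB; exact: mem_nth..].
by rewrite nth_uniq.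
Qed.

Lemma bessel_seq (s : seq H) x : uniq s -> (forall e, e \in s -> B e) ->
  \sum_(e <- s) csq (dot x e) <= nsq x.
Proof.
move=> us sB; have := bessel (basis_fam us sB) x.
by rewrite (big_nth 0) big_mkord.
Qed.

(** By maximality of the basis the residual of the projection of [x] onto the
closed span vanishes, so [x] is a limit of finite combinations; among the
combinations of given basis vectors the Fourier expansion is the best. *)
Lemma parseval_approx x (e : R) : 0 < e -> exists s : seq H,
  [/\ uniq s, (forall f, f \in s -> B f) & nsq x <= \sum_(f <- s) csq (dot x f) + e].
Proof.
move=> e0.
pose comb (l : seq (R[i] * H)) := \sum_(p <- l) p.1 *: p.2.
pose K := [set v | exists2 l, (forall p, p \in l -> B p.2) & v = comb l]%classic.
have K0 : K 0 by exists [::] => //; rewrite /comb big_nil.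
have KP a u v : K u -> K v -> K (a *: u + v).
  move=> [l lB ->] [k kB ->].
  exists ([seq (a * p.1, p.2) | p <- l] ++ k) => [p|].
    by rewrite mem_cat => /orP[/mapP[q /lB qB ->]|/kB].
  rewrite /comb big_cat big_map/= scaler_sumr; congr (_ + _).
  by apply: eq_bigr => p _; rewrite scalerA.
have [y [yK yo]] := orthogonal_projection dot_norm x K0 KP.
have xy : x = y.
  apply/eqP; rewrite -subr_eq0; apply/eqP/basisB.2 => f Bf; apply: yo.
  exists [:: (1, f)] => [p|]; first by rewrite inE => /eqP->.
  by rewrite /comb big_seq1 scale1r.
have [_ [l lB ->] ] := yK e e0; rewrite -xy => xl.
pose s := undup [seq p.2 | p <- l]; exists s; split; first exact: undup_uniq.
  by move=> f; rewrite mem_undup => /mapP[p /lB pB ->].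
have us : uniq s by exact: undup_uniq.
have sB f : f \in s -> B f by rewrite mem_undup => /mapP[p /lB pB ->].
have ons := basis_fam us sB.
rewrite (expansion_pythagoras ons) (big_nth 0) big_mkord lerD2l.
set w := expansion _ _ x; apply: le_trans (ltW xl).
have ow f : f \in s -> dot (x - w) f = 0.
  move=> fs; have fi : (index f s < size s)%N by rewrite index_mem.
  by have := expansion_orth ons x (Ordinal fi); rewrite /= nth_index.
have ol : dot (x - w) (comb l) = 0.
  rewrite dot_sumr big_seq big1// => p pl.
  by rewrite dotZr ow ?mulr0// mem_undup map_f.
have o2 : dot (x - w) w = 0.
  rewrite dot_sumr big1// => i _; rewrite dotZr ow ?mulr0//; exact: mem_nth.
have -> : x - comb l = (x - w) + (w - comb l) by rewrite addrA subrK.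
by rewrite (sqnormD _ _ (w - comb l)) dotBr ol o2 subrr mulr0 addr0 lerDl sqnorm_ge0.
Qed.

Lemma parseval_le x : ((nsq x)%:E <= \esum_(e in B) (csq (dot x e))%:E)%E.
Proof.
apply/lee_addgt0Pr => e e0; have [s [us sB h]] := parseval_approx x e0.
apply: le_trans (_ : (\sum_(f <- s) csq (dot x f) + e)%:E <= _)%E; first by rewrite lee_fin.
rewrite EFinD leeD2r//; apply: esum_ge; exists [set` s]%classic.
  by split; [exact: finite_seq | move=> f /= /sB].
by rewrite -fsbig_seq// sumEFin.
Qed.

(** Write [<Q y, y> = |S y|^2] with [S] the square root of [Q], expand by Parseval
in the basis, and exchange the sums: each basis vector [e] contributes
[sum_k |<C u_k, S e>|^2 <= |S e|^2]. *)
Lemma trace_contraction Q m (u : 'I_m -> H) C : positive_op dot Q ->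
  orthonormal_fam dot u -> linear C -> (forall x, nsq (C x) <= nsq x) ->
  ((\sum_k Re (dot (Q (C (u k))) (C (u k))))%:E <=
   \esum_(e in B) (Re (dot (Q e) e))%:E)%E.
Proof.
move=> pQ onu linC C1; have [pS SS] := op_sqrtP dot_norm pQ.
set S := op_sqrt dot Q in pS SS; have sS := positive_selfadjoint pS.
have QS y : Re (dot (Q y) y) = nsq (S y) by rewrite -SS /= sS.
under eq_bigr do rewrite QS; under eq_esum do rewrite QS.
rewrite -sumEFin; apply: le_trans (lee_sum _ (fun k _ => parseval_le (S (C (u k))))) _.
rewrite -esum_sum; last by move=> *; rewrite lee_fin csq_ge0.
apply: le_esum => e Be; rewrite sumEFin lee_fin.
under eq_bigr do rewrite sS.
exact: contraction_bessel.
Qed.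

(** For finitely many basis vectors [f], [<X^p f, f>] is almost
[sum_j l_j^p |<f, u_j>|^2] by quadrature, and summing over [f] first, Bessel
for the basis bounds the weight of each [l_j^p] by one. *)
Lemma trace_power_le X Y p (K : R) : positive_op dot X -> 1 <= p ->
  fcalc dot X (fun t => t `^ p) Y ->
  (forall m (u : 'I_m -> H), orthonormal_fam dot u ->
     \sum_k Re (dot (X (u k)) (u k)) `^ p <= K) ->
  (\esum_(e in B) (Re (dot (Y e) e))%:E <= K%:E)%E.
Proof.
move=> pX p1 fY hK.
have af := approximable_powR dot_norm pX p1.
apply: ub_ereal_sup => _ [F [finF FB] <-].
rewrite fsbig_finite//= sumEFin lee_fin.
set s : seq H := finmap.enum_fset (fset_set F).
have us : uniq s by exact: finmap.fset_uniq.
have sB f : f \in s -> B f by rewrite -[_ \in s]/(_ \in fset_set F) in_fset_set// => /set_mem /FB.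
(* one error for replacing [t^p] by [q] at the nodes, one for replacing [X^p]
   by [q(X)], for each of the [size s] basis vectors *)
apply: (@le_of_all_eps _ _ _ (2 * (size s)%:R)); first by rewrite mulr_ge0.
move=> e e0; have [q qf] := af e e0.
have [m [u [l [onu lM lE us_]]]] := spectral_quadrature dot_norm pX s (size q).
have h1 f : f \in s -> Re (dot (Y f) f) <= \sum_j (l j `^ p) * csq (dot f (u j)) + 2 * e.
  move=> fs; have nf : nsq f = 1 by rewrite /sqnorm basisB.1 ?eqxx; [|exact: sB..].
  have hf : hn f = 1 by rewrite /hnorm nf sqrtr1.
  have [_ qE] := us_ f fs.
  have t1 : Re (dot (poly_op q X f) f) <= \sum_j (l j `^ p) * csq (dot f (u j)) + e.
    rewrite qE// dot_suml Re_sum.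
    apply: le_trans (_ : \sum_j (l j `^ p + e) * csq (dot f (u j)) <= _).
      apply: ler_sum => j _; rewrite dotZl -mulrA ReZ (dotC _ (u j)).
      rewrite ler_wpM2r ?csq_ge0//; have := qf _ (lM j); rewrite ler_norml; lra.
    under eq_bigr do rewrite mulrDl.
    rewrite big_split/= lerD2l -mulr_sumr ler_piMr ?(ltW e0)//.
    by apply: le_trans (bessel onu f) _; rewrite nf.
  have t2 := Re_dot_le dot (poly_op q X f - Y f) f.
  have t3 := fY.2 q e (ltW e0) qf f.
  move: t2 t3; rewrite hf !mulr1 dotBl ReB => t2 t3.
  have := le_trans t2 t3; rewrite ler_norml; lra.
apply: le_trans (_ : \sum_(f <- s) (\sum_j (l j `^ p) * csq (dot f (u j)) + 2 * e) <= _).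
  by rewrite big_seq [leRHS]big_seq; apply: ler_sum => f /h1.
rewrite big_split/= big_const_seq count_predT iter_addr_0 mulrAC mulr_natr lerD2r.
rewrite exchange_big/=.
apply: le_trans (hK m u onu); apply: ler_sum => j _.
rewrite lE /= -mulr_sumr ler_piMr ?powR_ge0//.
under eq_bigr do rewrite dotC csq_conj.
apply: le_trans (bessel_seq (u j) us sB) _.
by rewrite /sqnorm onu eqxx.
Qed.

End Basis.

(** At [s = sum_i <P y_i, y_i>] the tangent of [t^p] is [d + c t] with
[d = (1 - p) s^p <= 0], so inserting it under the functional calculus and
summing gives [d sum_i |y_i|^2 + c s >= d + c s = s^p]. *)
Lemma operator_jensen P Q p m (y : 'I_m -> H) : positive_op dot P -> 1 <= p ->
  fcalc dot P (fun t => t `^ p) Q -> \sum_i nsq (y i) <= 1 ->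
  (\sum_i Re (dot (P (y i)) (y i))) `^ p <= \sum_i Re (dot (Q (y i)) (y i)).
Proof.
move=> pP p1 fQ y1; set s := \sum_i _.
have af := approximable_powR dot_norm pP p1.
have p0 : 0 < p by lra.
have s0 : 0 <= s.
  by apply: sumr_ge0 => i _; have := pP.2 (y i); rewrite lecE => /andP[].
pose c := p * s `^ (p - 1); pose d := s `^ p - c * s.
pose r : {poly R} := d%:P + c *: 'X.
have rE t : r.[t] = d + c * t by rewrite /r !hornerE.
have rP z : Re (dot (poly_op r P z) z) = d * nsq z + c * Re (dot (P z) z).
  rewrite (@poly_op_widen _ _ _ _ _ 2); last first.
    rewrite (leq_trans (size_polyD _ _))// geq_max (leq_trans (size_polyC_leq1 _))//.
    by rewrite (leq_trans (size_scale_leq _ _))// size_polyX.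
  rewrite !big_ord_recl big_ord0 !coefD !coefZ !coefC !coefX/= addr0 mulr0 addr0 add0r mulr1.
  by rewrite dotDl !dotZl ReD !ReZ.
have main z : d * nsq z + c * Re (dot (P z) z) <= Re (dot (Q z) z).
  rewrite -rP; apply: (fcalc_ge dot_norm pP af fQ) => t /andP[t0 _].
  have := powR_tangent p1 s0 t0; rewrite rE /d /c; lra.
apply: le_trans (_ : \sum_i (d * nsq (y i) + c * Re (dot (P (y i)) (y i))) <= _); last first.
  by apply: ler_sum => i _; exact: main.
rewrite big_split/= -!mulr_sumr -/s.
have cs : c * s = p * s `^ p by rewrite /c -mulrA (mulrC _ s) mulr_powRB1.
have d0 : d <= 0.
  by rewrite /d cs; have := powR_ge0 s p; nra.
have n0 : 0 <= \sum_i nsq (y i) by apply: sumr_ge0 => i _; exact: sqnorm_ge0.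
apply: le_trans (_ : d + c * s <= _); first by rewrite /d subrK.
by rewrite lerD2r; nra.
Qed.

End Trace.

(** * Minkowski inequality for finite families *)

Section FiniteMinkowski.
Context {R : realType}.

(** Normalization that also covers [alpha = 0], where every [x k] vanishes and the
quotients are zero. *)
Lemma powR_sum_div p (alpha : R) n (x : 'I_n -> R) : 1 <= p -> 0 <= alpha ->
  (forall k, 0 <= x k) -> \sum_k x k `^ p <= alpha `^ p ->
  \sum_k (x k / alpha) `^ p <= 1 /\ forall k, x k = alpha * (x k / alpha).
Proof.
move=> p1 a0 x0 xa; have p0 : p != 0 by rewrite gt_eqF//; lra.
have [az|an0] := eqVneq alpha 0.
  have xz k : x k = 0.
    apply: (@powR_eq0_eq0 _ _ p); apply/eqP; rewrite eq_le powR_ge0 andbT.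
    move: xa; rewrite az powR0//; apply: le_trans.
    by rewrite (bigD1 k)//= lerDl sumr_ge0// => *; exact: powR_ge0.
  split=> [|k]; last by rewrite xz mul0r mulr0.
  by rewrite big1// => k _; rewrite xz mul0r powR0.
split=> [|k]; last by rewrite mulrC divfK.
have ap : 0 < alpha by rewrite lt_def an0.
under eq_bigr do rewrite powRM// ?invr_ge0//.
rewrite -mulr_suml; apply: le_trans (ler_wpM2r (powR_ge0 _ _) xa) _.
by rewrite -powRM// ?invr_ge0// divff// powR1.
Qed.

(** Convexity of [t^p] at the weights [a alpha / s] and [b beta / s], where
[s = a alpha + b beta], applied to the normalized families. *)
Lemma finite_minkowski p a b (alpha beta : R) n (x y : 'I_n -> R) : 1 <= p ->
  0 <= a -> 0 <= b -> 0 <= alpha -> 0 <= beta ->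
  (forall k, 0 <= x k) -> (forall k, 0 <= y k) ->
  \sum_k x k `^ p <= alpha `^ p -> \sum_k y k `^ p <= beta `^ p ->
  \sum_k (a * x k + b * y k) `^ p <= (a * alpha + b * beta) `^ p.
Proof.
move=> p1 a0 b0 al0 be0 x0 y0 xa yb.
have [sx xE] := powR_sum_div p1 al0 x0 xa.
have [sy yE] := powR_sum_div p1 be0 y0 yb.
set s := a * alpha + b * beta.
have s0 : 0 <= s by rewrite addr_ge0// mulr_ge0.
have aa0 : 0 <= a * alpha by rewrite mulr_ge0.
have bb0 : 0 <= b * beta by rewrite mulr_ge0.
have [sz|sn0] := eqVneq s 0.
  have az : a * alpha = 0 by move: sz; rewrite /s; lra.
  have bz : b * beta = 0 by move: sz; rewrite /s; lra.
  rewrite big1 ?powR_ge0// => k _.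
  by rewrite xE yE !mulrA az bz !mul0r addr0 powR0// gt_eqF//; lra.
have sp : 0 < s by rewrite lt_def sn0.
pose w1 := a * alpha / s; pose w2 := b * beta / s.
have w10 : 0 <= w1 by rewrite divr_ge0.
have w20 : 0 <= w2 by rewrite divr_ge0.
have w12 : w1 + w2 = 1 by rewrite /w1 /w2 -mulrDl divff.
apply: le_trans (_ : \sum_k s `^ p * (w1 * (x k / alpha) `^ p + w2 * (y k / beta) `^ p) <= _).
  apply: ler_sum => k _.
  have -> : a * x k + b * y k = s * (w1 * (x k / alpha) + w2 * (y k / beta)).
    rewrite {1}xE {1}yE /w1 /w2; move: (x k / alpha) (y k / beta) => X Y.
    by field.
  have h1 : 0 <= x k / alpha by rewrite divr_ge0.
  have h2 : 0 <= y k / beta by rewrite divr_ge0.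
  have h3 : 0 <= w1 * (x k / alpha) + w2 * (y k / beta).
    by rewrite addr_ge0// mulr_ge0.
  rewrite (powRM _ s0 h3); apply: ler_wpM2l; first exact: powR_ge0.
  exact: powR_convex.
rewrite -mulr_sumr big_split/= -!mulr_sumr ler_piMr ?powR_ge0//.
rewrite -w12 lerD// ler_piMr//.
Qed.

End FiniteMinkowski.

(** * The power sum of a combination of a tuple and its Duggal transform *)

Section Main.
Context {R : realType} {H : completeNormedModType R[i]}.
Variable dot : {dot H for (@Num.conj R[i])}.
Hypothesis dot_norm : induces_norm dot.
Local Notation Re := complex.Re.
Local Notation nsq := (sqnorm dot).
Implicit Types (x y z v : H) (A C X P : H -> H).

Lemma positive_amgm P x y : positive_op dot P ->
  Re (dot (P x) y) <= (Re (dot (P x) x) + Re (dot (P y) y)) / 2.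
Proof.
move=> pP; have := pP.2 (x - y); rewrite lecE => /andP[_].
rewrite (linB pP.1.1) !dotBl !dotBr !ReB (positive_selfadjoint pP y x).
rewrite (dotC _ y (P x)) ReC /=; lra.
Qed.

Lemma dot_amgm x y : Re (dot x y) <= (nsq x + nsq y) / 2.
Proof. by have := sqnorm_ge0 dot (x - y); rewrite sqnormB; lra. Qed.

Lemma positive_form_ge0 P x : positive_op dot P -> 0 <= Re (dot (P x) x).
Proof. by move=> pP; have := pP.2 x; rewrite lecE => /andP[]. Qed.

Lemma poly_opMX (q : {poly R}) A x : linear A ->
  poly_op (q * 'X) A x = A (poly_op q A x).
Proof.
move=> linA; rewrite (@poly_op_widen _ _ _ _ _ (size q).+1); last first.
  by apply: leq_trans (size_polyMleq _ _) _; rewrite size_polyX addn2.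
rewrite poly_opE (lin_sum linA) big_ord_recl coefMX/= scale0r add0r.
by apply: eq_bigr => k _; rewrite coefMX/= (linZ linA).
Qed.

(** [G = g(X)] for the polynomial of [approx_inverse]: an approximate inverse of [X]
on the closure of its range.  When [X = |S|], the map [S G] plays the role of
the partial isometry in the polar decomposition of [S]. *)
Lemma polar_approx X (e : R) : positive_op dot X -> 0 < e -> exists2 G : H -> H, linear G &
  (forall x, nsq (X (G x)) <= nsq x /\
     Re (dot (X x) x) - e * nsq x <= Re (dot (X x) (X (G x)))).
Proof.
move=> pX e0; have linX := pX.1.1.
have M1 : 0 < opnorm X + 1 by rewrite ltr_wpDl// (opnorm_ge0 dot_norm pX.1).
have [g gP] := approx_inverse M1 e0.
exists (poly_op g X); first exact: poly_op_linear.
move=> x.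
have [m [u [l [onu lM lE us]]]] :=
  spectral_quadrature dot_norm pX [:: x] (maxn (size (g * 'X)) 2).
have [xE qE] := us x (mem_head _ _).

have {}lM j : 0 <= l j <= opnorm X + 1.
  by have /andP[-> h] := lM j; rewrite (le_trans h)// lerDl.
have XGx : X (poly_op g X x) = \sum_j ((l j * g.[l j])%:C * dot x (u j)) *: u j.
  rewrite -poly_opMX// qE ?leqW ?leq_maxl//; apply: eq_bigr => j _.
  by rewrite hornerMX (mulrC g.[l j]).
have Xx : X x = \sum_j ((l j)%:C * dot x (u j)) *: u j.
  rewrite -[X x]poly_opX qE ?size_polyX ?leqW ?leq_maxr//.
  by apply: eq_bigr => j _; rewrite hornerX.
have nx : nsq x = \sum_j csq (dot x (u j)).
  by rewrite /sqnorm xE Re_sum; apply: eq_bigr => j _; rewrite (dotC _ (u j)).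
split.
  rewrite XGx sqnorm_comb// nx; apply: ler_sum => j _.
  have [h0 h1 _] := gP _ (lM j).
  by rewrite csqM csqR ler_piMl ?csq_ge0// exprn_ile1.
have -> : Re (dot (X x) x) = \sum_j l j * csq (dot x (u j)).
  rewrite Xx dot_suml Re_sum; apply: eq_bigr => j _.
  by rewrite dotZl -mulrA ReZ (dotC _ (u j)).
have -> : Re (dot (X x) (X (poly_op g X x))) =
    \sum_j l j ^+ 2 * g.[l j] * csq (dot x (u j)).
  rewrite XGx Xx dot_comb2// Re_sum; apply: eq_bigr => j _.
  set z := dot x (u j); rewrite (_ : _ * _ = (l j * (l j * g.[l j]))%:C * (z * Num.conj z)).
    by rewrite ReZ -/(csq z); ring.
  by rewrite conjM conjRC [in RHS]CM; ring.
rewrite nx mulr_sumr -sumrB; apply: ler_sum => j _.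
by rewrite -mulrBl ler_wpM2r ?csq_ge0//; have [] := gP _ (lM j).
Qed.

Lemma bounded_op_sum n (F : 'I_n -> H -> H) : (forall i, bounded_op (F i)) ->
  bounded_op (\sum_i F i).
Proof.
move=> bF; apply: (big_ind bounded_op) => //; last first.
  by move=> A C bA bC; have := bounded_op_comb dot_norm 1 1 bA bC; rewrite !scale1r.
have z0 x : (0 : H -> H) x = 0 by [].
apply: (bounded_opI dot_norm _ (lexx 0)) => [a x y|x]; rewrite !z0.
  by rewrite scaler0 addr0.
by rewrite sqnorm0 mul0r.
Qed.

Section Modulus.
Variables (d : nat) (S : 'I_d -> H -> H).
Hypothesis bS : forall i, bounded_op (S i).
Local Notation X := (spherical_modulus dot S).

Lemma gram_dot x y : dot ((\sum_(i < d) (adjoint dot (S i) \o S i)) x) y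
  = \sum_i dot (S i x) (S i y).
Proof.
rewrite fct_sumE dot_suml; apply: eq_bigr => i _ /=.
by rewrite dotC -(adjointP dot_norm (bS i)).2 -dotC.
Qed.

Lemma modulusP : positive_op dot X /\
  forall x y, dot (X x) (X y) = \sum_i dot (S i x) (S i y).
Proof.
have pG : positive_op dot (\sum_(i < d) (adjoint dot (S i) \o S i)).
  split.
    apply: bounded_op_sum => i.
    exact: (bounded_op_comp dot_norm (adjointP dot_norm (bS i)).1 (bS i)).
  by move=> x; rewrite gram_dot sumr_ge0.
have [pX XX] := op_sqrtP dot_norm pG; split=> // x y.
by rewrite -gram_dot -XX /= -(positive_selfadjoint pX).
Qed.

Lemma modulus_nsq x : nsq (X x) = \sum_i nsq (S i x).
Proof. by rewrite /sqnorm modulusP.2 Re_sum. Qed.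

End Modulus.

Section Polar.
Variables (d : nat) (p : R) (T V : 'I_d -> H -> H) (B : set H).
Hypotheses (p1 : 1 <= p) (bT : forall i, bounded_op (T i)).
Hypothesis polarTV : spherical_polar dot T V.
Hypothesis basisB : is_orthonormal_basis dot B.
Local Notation P := (spherical_modulus dot T).
Let bV : forall i, bounded_op (V i). Proof. by case: polarTV. Qed.
Let pP : positive_op dot P := (modulusP bT).1.

(** The sum is [<E x, x> = |E x|^2] for the projection [E]. *)
Lemma polar_contraction x : \sum_i nsq (V i x) <= nsq x.
Proof.
have [_ _ prj] := polarTV; have [Ex xEx] := prj x.
set E := \sum_i _ in Ex xEx *.
have o : dot (x - E x) (E x) = 0 by exact: xEx.
have -> : \sum_i nsq (V i x) = nsq (E x).
  transitivity (Re (dot (E x) x)); first by rewrite gram_dot// Re_sum.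
  by rewrite dotC ReC -{1}(subrK (E x) x) dotDl o add0r.
by rewrite -{2}(subrK (E x) x) (sqnormD _ _ (E x)) o mulr0 addr0 lerDr sqnorm_ge0.
Qed.

Variables (Q : H -> H) (tau : R).
Hypotheses (fQ : fcalc dot P (fun t => t `^ p) Q)
  (Qtau : (\esum_(e in B) (Re (dot (Q e) e))%:E <= tau%:E)%E).

Let pQ : positive_op dot Q.
Proof.
apply: (fcalc_positive dot_norm pP (approximable_powR dot_norm pP p1) fQ) => t _.
exact: powR_ge0.
Qed.

(** [Q] is [P^p].  Jensen moves the power inside, and each of the [m] compressions
costs one trace of [Q]. *)
Lemma compressed_power_sum m n (C : 'I_m -> H -> H) (u : 'I_n -> H) :
  (forall i, linear (C i)) -> (forall x, \sum_i nsq (C i x) <= nsq x) ->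
  orthonormal_fam dot u ->
  \sum_k (\sum_i Re (dot (P (C i (u k))) (C i (u k)))) `^ p <= m%:R * tau.
Proof.
move=> linC C1 onu.
apply: le_trans (_ : \sum_k \sum_i Re (dot (Q (C i (u k))) (C i (u k))) <= _).
  apply: ler_sum => k _; apply: (operator_jensen dot_norm pP p1 fQ).
  by apply: le_trans (C1 _) _; rewrite /sqnorm onu eqxx.
rewrite exchange_big/= -[m in m%:R]card_ord mulr_natl -sumr_const.
apply: ler_sum => i _; rewrite -lee_fin; apply: le_trans Qtau.
apply: (trace_contraction dot_norm basisB pQ onu (linC i)) => x.
apply: le_trans (C1 x); rewrite (bigD1 i)//= lerDl.
by apply: sumr_ge0 => j _; exact: sqnorm_ge0.
Qed.

Lemma powR_half_sum n (x y : 'I_n -> R) (c : R) :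
  (forall k, 0 <= x k) -> (forall k, 0 <= y k) ->
  \sum_k x k `^ p <= c -> \sum_k y k `^ p <= c ->
  \sum_k ((x k + y k) / 2) `^ p <= c.
Proof.
move=> x0 y0 xc yc.
apply: le_trans (_ : \sum_k (2^-1 * x k `^ p + 2^-1 * y k `^ p) <= _).
  apply: ler_sum => k _; rewrite (_ : _ / 2 = 2^-1 * x k + 2^-1 * y k); last by ring.
  by apply: powR_convex => //; lra.
by rewrite big_split/= -!mulr_sumr; lra.
Qed.

(** Up to [e], [<X u, u>] is at most [a xi + b eta], where [xi] averages [<P u, u>]
and [<P D u, D u>] (one compression each) and [eta] averages the sums over [V_i]
and over [W_i] ([d] compressions each). *)
Lemma mean_power_sum (a b : R) (S : 'I_d -> H -> H) n (u : 'I_n -> H) :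
  0 <= a -> 0 <= b -> 0 <= tau ->
  (forall i, S i = a%:C *: T i + b%:C *: (P \o V i)) -> orthonormal_fam dot u ->
  \sum_k Re (dot (spherical_modulus dot S (u k)) (u k)) `^ p <=
    ((a + b * d%:R `^ p^-1) * tau `^ p^-1) `^ p.
Proof.
move=> a0 b0 t0 SE onu; pose X := spherical_modulus dot S; rewrite -/X.
have p0 : 0 < p := lt_le_trans ltr01 p1.
have bS i : bounded_op (S i).
  rewrite SE; exact: (bounded_op_comb dot_norm _ _ (bT i) (bounded_op_comp dot_norm pP.1 (bV i))).
have [pX XS] := modulusP bS; rewrite -/X in pX XS.
have XSn x := modulus_nsq bS x; rewrite -/X in XSn.
set K := _ * _.
have K0 : 0 <= K by rewrite mulr_ge0 ?addr_ge0 ?mulr_ge0 ?powR_ge0.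
pose N := (n%:R : R) `^ p^-1.
have powK (c : R) : 0 <= c -> (c `^ p^-1) `^ p = c.
  by move=> c0; rewrite -powRrM mulVf ?powRr1// gt_eqF.
set L := \sum_k _.
have L0 : 0 <= L by apply: sumr_ge0 => k _; exact: powR_ge0.
have u1 k : nsq (u k) = 1 by rewrite /sqnorm onu eqxx.
(* the error [e] of [polar_approx] enters once for each of the [n] vectors, hence
   with [l^p] norm [N e] *)
suff main (e : R) : 0 < e -> L `^ p^-1 <= K + N * e.
  rewrite -(powK L L0) ge0_ler_powR ?nnegrE ?powR_ge0 ?(ltW p0)//.
  by apply: (le_of_all_eps _ main); exact: powR_ge0.
move=> e0; have [G linG GP] := polar_approx pX e0.
pose W i x := S i (G x).
have linW i : linear (W i) by move=> c x y; rewrite /W linG (bS i).1.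
have W1 x : \sum_i nsq (W i x) <= nsq x.
  by have [+ _] := GP x; rewrite XSn.
pose D x := \sum_i adjoint dot (V i) (W i x).
have linD_ : linear D.
  move=> c x y; rewrite /D scaler_sumr -big_split; apply: eq_bigr => i _ /=.
  by rewrite linW (adjointP dot_norm (bV i)).1.1.
have Ddot z x : dot z (D x) = \sum_i dot (V i z) (W i x).
  by rewrite dot_sumr; apply: eq_bigr => i _; rewrite (adjointP dot_norm (bV i)).2.
have D1 x : nsq (D x) <= nsq x.
  have : nsq (D x) <= (nsq (D x) + nsq x) / 2.
    rewrite {1}/sqnorm Ddot Re_sum.
    apply: le_trans (_ : \sum_i (nsq (V i (D x)) + nsq (W i x)) / 2 <= _).
      by apply: ler_sum => i _; exact: dot_amgm.
    rewrite -mulr_suml ler_wpM2r// big_split/= lerD//; exact: polar_contraction.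
  lra.
pose f C x := Re (dot (P (C x)) (C x)).
have f0 C x : 0 <= f C x by exact: positive_form_ge0.
pose xi k := (f id (u k) + f D (u k)) / 2.
pose eta k := (\sum_i f (V i) (u k) + \sum_i f (W i) (u k)) / 2.
have sum1 C : linear C -> (forall x, nsq (C x) <= nsq x) ->
    \sum_k f C (u k) `^ p <= tau.
  move=> linC C1; rewrite -[tau]mul1r.
  rewrite (eq_bigr (fun k => (\sum_(i < 1) f C (u k)) `^ p)); last first.
    by move=> k _; rewrite big_ord1.
  by apply: (@compressed_power_sum 1 n (fun=> C)) => // x; rewrite big_ord1.
have sumd (C : 'I_d -> H -> H) : (forall i, linear (C i)) ->
    (forall x, \sum_i nsq (C i x) <= nsq x) ->
    \sum_k (\sum_i f (C i) (u k)) `^ p <= d%:R * tau.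
  by move=> linC C1; exact: compressed_power_sum.
have xi0 k : 0 <= xi k by rewrite divr_ge0// addr_ge0.
have eta0 k : 0 <= eta k.
  by rewrite divr_ge0// addr_ge0//; apply: sumr_ge0 => i _.
have sxi : \sum_k xi k `^ p <= (tau `^ p^-1) `^ p.
  by rewrite powK//; apply: powR_half_sum => //; apply: sum1.
have seta : \sum_k eta k `^ p <= (d%:R `^ p^-1 * tau `^ p^-1) `^ p.
  rewrite powRM ?powR_ge0// !powK//; apply: powR_half_sum.
  - by move=> k; apply: sumr_ge0.
  - by move=> k; apply: sumr_ge0.
  - by apply: sumd => [i|]; [exact: (bV i).1 | exact: polar_contraction].
  - exact: sumd.
have szeta : \sum_k (a * xi k + b * eta k) `^ p <= K `^ p.
  rewrite (_ : K = a * tau `^ p^-1 + b * (d%:R `^ p^-1 * tau `^ p^-1)); last first.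
    by rewrite /K; ring.
  by apply: finite_minkowski; rewrite ?mulr_ge0 ?powR_ge0.
have bound k : Re (dot (X (u k)) (u k)) <= 1 * (a * xi k + b * eta k) + e * 1.
  have [_] := GP (u k); rewrite u1 mulr1 mul1r lerBlDr => /le_trans; apply.
  rewrite lerD2r XS Re_sum.
  have Sdot i : Re (dot (S i (u k)) (S i (G (u k)))) =
      a * Re (dot (T i (u k)) (W i (u k))) + b * Re (dot (P (V i (u k))) (W i (u k))).
    by rewrite {1}SE !fctE dotDl !dotZl ReD !ReZ.
  under eq_bigr do rewrite Sdot.
  rewrite big_split/= -!mulr_sumr lerD// ler_wpM2l//.
    have -> : \sum_i Re (dot (T i (u k)) (W i (u k))) = Re (dot (P (u k)) (D (u k))).
      rewrite Ddot Re_sum; apply: eq_bigr => i _.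
      by have [_ -> _] := polarTV.
    exact: positive_amgm.
  rewrite /eta -big_split/= mulr_suml; apply: ler_sum => i _.
  exact: positive_amgm.
have z0 k : 0 <= a * xi k + b * eta k by rewrite addr_ge0// mulr_ge0.
have : L <= (1 * K + e * N) `^ p.
  apply: le_trans (_ : \sum_k (1 * (a * xi k + b * eta k) + e * 1) `^ p <= _).
    apply: ler_sum => k _; rewrite ge0_ler_powR ?nnegrE ?(ltW p0)//.
      exact: positive_form_ge0.
    by rewrite !mul1r mulr1 addr_ge0// ltW.
  have sN : \sum_(k < n) 1 `^ p <= N `^ p.
    by rewrite (powK _ (ler0n _ _)) powR1 sumr_const card_ord.
  exact: (finite_minkowski p1 ler01 (ltW e0) K0 (powR_ge0 _ _) z0 (fun=> ler01) szeta sN).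
have KN : 0 <= 1 * K + e * N by rewrite mul1r addr_ge0// mulr_ge0 ?powR_ge0// ltW.
move=> /(ge0_ler_powR (_ : 0 <= p^-1)); rewrite invr_ge0 => /(_ (ltW p0)).
rewrite !nnegrE => /(_ L0 (powR_ge0 _ _)); rewrite -powRrM mulfV ?gt_eqF//.
by rewrite powRr1// mul1r (mulrC e).
Qed.

End Polar.
End Main.

(** * Norm estimates *)

Lemma poweR_root_le (R : realType) (p K : R) (x : \bar R) : 0 < p -> (0 <= x)%E ->
  0 <= K -> (x <= (K `^ p)%:E)%E -> (x `^ p^-1 <= K%:E)%E.
Proof.
move=> p0; case: x => [x| |]//; rewrite poweR_EFin !lee_fin => x0 K0 xK.
rewrite -[leRHS]powRr1// -(mulfV (lt0r_neq0 p0)) powRrM.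
by rewrite ge0_ler_powR ?nnegrE ?powR_ge0// invr_ge0 ltW.
Qed.

Section Conclusion.
Context {R : realType} {H : completeNormedModType R[i]}.
Variable dot : {dot H for (@Num.conj R[i])}.
Hypothesis dot_norm : induces_norm dot.
Variables (d : nat) (p : R) (T V : 'I_d -> H -> H).
Hypotheses (p1 : 1 <= p) (schattenT : spherical_schatten dot p T).
Hypothesis polarTV : spherical_polar dot T V.
Local Notation P := (spherical_modulus dot T).
Local Notation Re := complex.Re.

Let bT := schattenT.1.
Let pP : positive_op dot P := (modulusP dot_norm bT).1.

Lemma trace_ge0 A : positive_op dot A -> (0 <= trace dot A)%E.
Proof.
by move=> pA; apply: esum_ge0 => e _; rewrite lee_fin positive_form_ge0.
Qed.

Lemma op_powR_fcalc A : positive_op dot A -> fcalc dot A (fun t => t `^ p) (op_powR A p).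
Proof.
by move=> pA; apply: (fun_calcP dot_norm pA); exact: approximable_powR.
Qed.

Lemma op_powR_positive A : positive_op dot A -> positive_op dot (op_powR A p).
Proof.
move=> pA; have af := approximable_powR dot_norm pA p1.
by apply: (fcalc_positive dot_norm pA af (op_powR_fcalc pA)) => t _; exact: powR_ge0.
Qed.

Lemma mean_bounded (a b : R) i : bounded_op (a%:C *: T i + b%:C *: (P \o V i)).
Proof.
have [bV _ _] := polarTV.
exact: (bounded_op_comb dot_norm _ _ (bT i) (bounded_op_comp dot_norm pP.1 (bV i))).
Qed.

(** [xget] returns the empty set when there is no orthonormal basis; the trace is
then zero. *)
Lemma mean_trace_le (a b : R) (S : 'I_d -> H -> H) : 0 <= a -> 0 <= b ->
  (forall i, S i = a%:C *: T i + b%:C *: (P \o V i)) ->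
  (trace dot (op_powR (spherical_modulus dot S) p) <=
   (((a + b * d%:R `^ p^-1) * fine (trace dot (op_powR P p)) `^ p^-1) `^ p)%:E)%E.
Proof.
move=> a0 b0 SE; have bS i : bounded_op (S i) by rewrite SE; exact: mean_bounded.
have pX := (modulusP dot_norm bS).1.
set tau := fine _; have tauE : trace dot (op_powR P p) = tau%:E.
  rewrite /tau fineK// (ge0_fin_numE (trace_ge0 (op_powR_positive pP))).
  exact: schattenT.2.
have t0 : 0 <= tau.
  by rewrite fine_ge0//; exact: trace_ge0 (op_powR_positive pP).
have [basis|nobasis] := pselect (exists B, is_orthonormal_basis dot B); last first.
  have -> : trace dot (op_powR (spherical_modulus dot S) p) = 0%E.
    rewrite /trace /orthonormal_basis xgetPN ?esum_set0// => B hB.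
    by apply: nobasis; exists B.
  by rewrite lee_fin powR_ge0.
have basisB : is_orthonormal_basis dot (orthonormal_basis dot).
  by have := xgetPex (set0 : set H) basis.
apply: (trace_power_le dot_norm basisB pX p1 (op_powR_fcalc pX)) => m u onu.
apply: (mean_power_sum dot_norm p1 bT polarTV basisB (op_powR_fcalc pP)) => //.
by rewrite -tauE.
Qed.

Lemma mean_norm_le (a b : R) (S : 'I_d -> H -> H) : 0 <= a -> 0 <= b ->
  (forall i, S i = a%:C *: T i + b%:C *: (P \o V i)) ->
  spherical_schatten dot p S /\ (spherical_norm dot p S <=
     (a + b * d%:R `^ p^-1)%:E * spherical_norm dot p T)%E.
Proof.
move=> a0 b0 SE; have h := mean_trace_le a0 b0 SE.
have bS i : bounded_op (S i) by rewrite SE; exact: mean_bounded.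
have pX := (modulusP dot_norm bS).1.
have p0 : 0 < p := lt_le_trans ltr01 p1.
have X0 := trace_ge0 (op_powR_positive pX).
split; first by split=> //; exact: le_lt_trans h (ltry _).
have P0 := trace_ge0 (op_powR_positive pP).
have -> : spherical_norm dot p T = (fine (trace dot (op_powR P p)) `^ p^-1)%:E.
  by rewrite -poweR_EFin (fineK (eqbRL (ge0_fin_numE P0) schattenT.2)).
rewrite -EFinM; apply: (poweR_root_le p0 X0 _ h).
by rewrite mulr_ge0 ?addr_ge0 ?mulr_ge0 ?powR_ge0.
Qed.

End Conclusion.

Theorem theorem3p2 (R : realType) (H : completeNormedModType R[i])
  (dot : {dot H for (@Num.conj R[i])}) (dot_norm : induces_norm dot)
  (sepH : separable_space H) (d : nat) (p : R) (p1 : 1 <= p)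
  (T V : 'I_d -> H -> H)
  (schattenT : spherical_schatten dot p T) (polarTV : spherical_polar dot T V) :
  (forall l : R, 0 <= l <= 1 ->
     spherical_schatten dot p (lambda_mean dot l T V) /\
     (spherical_norm dot p (lambda_mean dot l T V) <=
       (l + (1 - l) * d%:R `^ p^-1)%:E * spherical_norm dot p T)%E) /\
  (spherical_norm dot p (duggal dot T V) <=
    (d%:R `^ p^-1)%:E * spherical_norm dot p T)%E /\
  (spherical_norm dot p (mean_transform dot T V) <=
    ((1 + d%:R `^ p^-1) / 2)%:E * spherical_norm dot p T)%E.
Proof.
have main := mean_norm_le dot_norm p1 schattenT polarTV.
split=> [l /andP[l0 l1]|]; first by apply: main; rewrite ?subr_ge0.
split.
  rewrite -[d%:R `^ _]mul1r -[1 * _]add0r.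
  apply: (main 0 1 _ (lexx 0) ler01 _).2 => i.
  by rewrite scale0r add0r scale1r.
have -> : (1 + d%:R `^ p^-1) / 2 = 2^-1 + 2^-1 * d%:R `^ p^-1 by ring.
have h0 : 0 <= 2^-1 :> R by rewrite invr_ge0.
apply: (main 2^-1 2^-1 _ h0 h0 _).2 => i.
by rewrite /mean_transform scalerDr fmorphV rmorph_nat.
Qed.
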